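(* An $(n+1)$-dimensional solvable Leibniz algebra over $\mathbb{C}$ with nilradical $F_n^2$ is isomorphic to one of the following pairwise non-isomorphic algebras, each given in a basis $\{e_1,\dots,e_n,x\}$, where in every one of them $$[e_1,e_1]=e_3,\qquad [e_i,e_1]=e_{i+1}\quad(3\le i\le n-1),$$ and the remaining nonzero products are: $R_1(\alpha)$, $\alpha\in\{0,1\}$: $[e_1,x]=-e_1$, $[e_i,x]=-(i-1)e_i$ $(3\le i\le n)$, $[x,e_1]=e_1$, $[x,x]=\alpha e_2$; $R_2(\alpha)$, $\alpha\ne 0$: $[e_1,x]=-e_1$, $[e_i,x]=-(i-1)e_i$ $(3\le i\le n)$, $[x,e_1]=e_1$, $[e_2,x]=\alpha e_2$; $R_3$: $[e_1,x]=-e_1$, $[e_i,x]=-(i-1)e_i$ $(3\le i\le n)$, $[x,e_1]=e_1$, $[e_2,x]=(1-n)e_2+e_n$; $R_4(\alpha)$, $\alpha\neq 1$: $[e_1,x]=-e_1$, $[e_i,x]=-(i-1)e_i$ $(3\le i\le n)$, $[x,e_1]=e_1$, $[e_2,x]=-\alpha e_2$, $[x,e_2]=\alpha e_2$; $R_5(\alpha)$, $\alpha\in\{0,1\}$: $[e_1,x]=-e_1-\alpha e_2$, $[e_i,x]=-(i-1)e_i$ $(3\le i\le n)$, $[x,e_1]=e_1+\alpha e_2$, $[e_2,x]=-e_2$, $[x,e_2]=e_2$; $R_6(\alpha_3,\alpha_4,\dots,\alpha_n,\lambda,\delta)$, $\delta\in\{0,-1\}$: $[e_1,x]=\sum_{i=3}^{n}\alpha_i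 e_i$, $[e_i,x]=\sum_{j=i+1}^{n}\alpha_{j-i+2}e_j$ $(3\le i\le n-1)$, $[x,x]=\lambda e_n$, $[e_2,x]=e_2$, $[x,e_2]=\delta e_2$. In the algebra $R_6(\alpha_3,\alpha_4,\dots,\alpha_n,\lambda,\delta)$ the first non-vanishing parameter among $\alpha_3,\alpha_4,\dots,\alpha_n,\lambda$ can be scaled to $1$.
   Context: All algebras are finite-dimensional over $\mathbb{C}$, and all parameters are complex numbers; in tables of multiplication, omitted products of basis elements are zero. A Leibniz algebra is a vector space $L$ with a bilinear bracket satisfying $[x,[y,z]]=[[x,y],z]-[[x,z],y]$ for all $x,y,z\in L$. Set $L^1=L$, $L^{k+1}=[L^k,L]$ and $L^{[1]}=L$, $L^{[s+1]}=[L^{[s]},L^{[s]}]$; $L$ is nilpotent if some $L^k=0$ and solvable if some $L^{[s]}=0$. The nilradical of $L$ is its maximal nilpotent (two-sided) ideal; ''with nilradical $F_n^2$'' means that the nilradical is isomorphic to $F_n^2$. The algebra $F_n^2$ is the $n$-dimensional Leibniz algebra with basis $\{e_1,\dots,e_n\}$ and products $[e_1,e_1]=e_3$ and $[e_i,e_1]=e_{i+1}$ for $3\le i\le n-1$.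
   Formalization: ''Pairwise non-isomorphic'' is literally false: R_1(0)=R_4(0), and R_6(0,1,λ,δ)≅R_6(0,1,−λ,δ) for n=4. It is stated as: isomorphic listed algebras have the same table, or are R_6's with equal δ and parameters related by α_i→c^{i−2}α_i, λ→c^{n−1}λ, c≠0. *)

(* Defs.v *)
From HB Require Import structures.
From mathcomp Require Import all_boot all_order all_algebra.
From mathcomp Require Import reals complex.

Set Implicit Arguments.
Unset Strict Implicit.
Unset Printing Implicit Defensive.

Import GRing.Theory.
Local Open Scope ring_scope.

Section Leibniz.
Variables (K : fieldType) (L : vectType K) (br : L -> L -> L).

Definition bilinear_bracket : Prop :=
  (forall v, linear (br^~ v)) /\ (forall u, linear (br u)).

Definition leibniz_algebra : Prop :=
  bilinear_bracket /\
  (forall x y z, br x (br y z) = br (br x y) z - br (br x z) y).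

(* The span of the brackets [u, v], u in U and v in V (for a bilinear bracket);
   compare prodv in falgebra. *)
Definition brv (U V : {vspace L}) : {vspace L} :=
  <<[seq br u v | u <- vbasis U, v <- vbasis V]>>%VS.

(* lcs N k is N^{k+1}: N^1 = N, N^{k+1} = [N^k, N]. *)
Definition lcs (N : {vspace L}) (k : nat) : {vspace L} :=
  iter k (fun U => brv U N) N.

(* derived_series k is L^{[k+1]}. *)
Definition derived_series (k : nat) : {vspace L} :=
  iter k (fun U => brv U U) fullv.

Definition nilpotent_sub (N : {vspace L}) : Prop := exists k, lcs N k = 0%VS.

Definition solvable_algebra : Prop := exists k, derived_series k = 0%VS.

Definition ideal (I : {vspace L}) : Prop :=
  forall u v, u \in I -> br u v \in I /\ br v u \in I.

Definition is_nilradical (N : {vspace L}) : Prop :=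
  [/\ ideal N, nilpotent_sub N &
      forall I : {vspace L}, ideal I -> nilpotent_sub I -> (I <= N)%VS].

End Leibniz.

(* W, with the bracket it inherits from V, is isomorphic to (U, bu). *)
Definition iso_onto (K : fieldType) (U V : vectType K)
    (bu : U -> U -> U) (bv : V -> V -> V) (W : {vspace V}) : Prop :=
  exists f : 'Hom(U, V),
    [/\ lker f = 0%VS, limg f = W & forall u v, f (bu u v) = bv (f u) (f v)].

Definition alg_iso (K : fieldType) (U V : vectType K)
    (bu : U -> U -> U) (bv : V -> V -> V) : Prop :=
  iso_onto bu bv fullv.

Section Tables.
Variable K : fieldType.

(* Basis vectors are numbered from 1, as in e_1, ..., e_m. *)
Definition e (m i : nat) : 'rV[K]_m := \row_(j < m) (j.+1 == i)%:R.

Definition table_bracket (m : nat) (t : nat -> nat -> 'rV[K]_m)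
    (u v : 'rV[K]_m) : 'rV[K]_m :=
  \sum_(i < m) \sum_(j < m) (u 0 i * v 0 j) *: t i.+1 j.+1.

(* The products [e_i, e_j] of F_n^2, with values in an ambient K^m, m >= n. *)
Definition F2_table (n m i j : nat) : 'rV[K]_m :=
  match i, j with
  | 1%N, 1%N => e m 3
  | _, 1%N => if (3 <= i < n)%N then e m i.+1 else 0
  | _, _ => 0
  end.

Definition F2 (n : nat) : 'rV[K]_n -> 'rV[K]_n -> 'rV[K]_n :=
  table_bracket (F2_table n n).

Definition has_nilradical_F2 (n : nat) (L : vectType K) (br : L -> L -> L) :
    Prop :=
  exists N : {vspace L}, is_nilradical br N /\ iso_onto (@F2 n) br N.

(* In R6 only the values a_3, ..., a_n of the first parameter are used. *)
Inductive entry : Type :=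
  | R1 of K
  | R2 of K
  | R3
  | R4 of K
  | R5 of K
  | R6 of (nat -> K) & K & K.

Definition admissible (p : entry) : Prop :=
  match p with
  | R1 a => a = 0 \/ a = 1
  | R2 a => a <> 0
  | R3 => True
  | R4 a => a <> 1
  | R5 a => a = 0 \/ a = 1
  | R6 _ _ d => d = 0 \/ d = -1
  end.

(* Names of the basis vectors e_1, ..., e_n, x of K^{n+1}; x comes last. *)
Inductive gen : Type := E of nat | X.

Definition gen_of (n k : nat) : gen := if k == n.+1 then X else E k.

(* The products other than [e_i, e_j]. *)
Definition products_with_x (n : nat) (p : entry) (g h : gen) : 'rV[K]_n.+1 :=
  let e := e n.+1 in
  match p with
  | R1 a =>
    match g, h with
    | E 1, X => - e 1%N
    | E i, X => if (3 <= i <= n)%N then - (i - 1)%:R *: e i else 0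
    | X, E 1 => e 1%N
    | X, X => a *: e 2%N
    | _, _ => 0
    end
  | R2 a =>
    match g, h with
    | E 1, X => - e 1%N
    | E 2, X => a *: e 2%N
    | E i, X => if (3 <= i <= n)%N then - (i - 1)%:R *: e i else 0
    | X, E 1 => e 1%N
    | _, _ => 0
    end
  | R3 =>
    match g, h with
    | E 1, X => - e 1%N
    | E 2, X => (1 - n%:R) *: e 2%N + e n
    | E i, X => if (3 <= i <= n)%N then - (i - 1)%:R *: e i else 0
    | X, E 1 => e 1%N
    | _, _ => 0
    end
  | R4 a =>
    match g, h with
    | E 1, X => - e 1%N
    | E 2, X => - a *: e 2%N
    | E i, X => if (3 <= i <= n)%N then - (i - 1)%:R *: e i else 0
    | X, E 1 => e 1%N
    | X, E 2 => a *: e 2%N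
    | _, _ => 0
    end
  | R5 a =>
    match g, h with
    | E 1, X => - e 1%N - a *: e 2%N
    | E 2, X => - e 2%N
    | E i, X => if (3 <= i <= n)%N then - (i - 1)%:R *: e i else 0
    | X, E 1 => e 1%N + a *: e 2%N
    | X, E 2 => e 2%N
    | _, _ => 0
    end
  | R6 a l d =>
    match g, h with
    | E 1, X => \sum_(3 <= i < n.+1) a i *: e i
    | E 2, X => e 2%N
    | E i, X => if (3 <= i < n)%N
                then \sum_(i.+1 <= j < n.+1) a (j - i + 2)%N *: e j else 0
    | X, E 2 => d *: e 2%N
    | X, X => l *: e n
    | _, _ => 0
    end
  end.

Definition entry_table (n : nat) (p : entry) (g h : gen) : 'rV[K]_n.+1 :=
  match g, h with
  | E i, E j => F2_table n n.+1 i j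
  | _, _ => products_with_x n p g h
  end.

Definition alg (n : nat) (p : entry) :
    'rV[K]_n.+1 -> 'rV[K]_n.+1 -> 'rV[K]_n.+1 :=
  table_bracket (fun i j => entry_table n p (gen_of n i) (gen_of n j)).

(* The first nonzero term of a_3, ..., a_n, l, or 0 if they all vanish. *)
Definition first_nonvanishing (n : nat) (a : nat -> K) (l : K) : K :=
  let s := rcons [seq a i | i <- iota 3 (n - 2)] l in
  nth 0 s (find (fun z => z != 0) s).

(* The effect on (a_3, ..., a_n, l) of replacing e_1 by c^-1 e_1, hence e_i by
   c^-(i-1) e_i for i >= 3. *)
Definition scale_coef (c : K) (a : nat -> K) : nat -> K :=
  fun i => c ^+ (i - 2) * a i.

Definition scale_last (n : nat) (c l : K) : K := c ^+ (n - 1) * l.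

Definition R6_rescaling (n : nat) (p q : entry) : Prop :=
  match p, q with
  | R6 a l d, R6 a' l' d' =>
      d' = d /\
      exists c : K,
        [/\ c != 0,
            forall i, (3 <= i <= n)%N -> a' i = scale_coef c a i &
            l' = scale_last n c l]
  | _, _ => False
  end.

End Tables.

Arguments R3 {K}.
Arguments alg {K} n p.

(* Main.v *)
Require Import Defs.
From HB Require Import structures.
From mathcomp Require Import all_boot all_order all_algebra.
From mathcomp Require Import reals complex.
From mathcomp Require Import ring.

Set Implicit Arguments.
Unset Strict Implicit.
Unset Printing Implicit Defensive.

Import GRing.Theory.
Local Open Scope ring_scope.

(* Write a, b for generators e_1, e_2 of the nilradical N, and R_u for right
   multiplication by u, which is a derivation. The powers R_a^k(a), k >= 1, lie in the
   right annihilator and R_x is a derivation of N, so R_x is determined by [a, x] and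
   [b, x]; it is triangular, with eigenvalue (k + 1) r on R_a^k(a), where r is the
   coefficient of a in [a, x], and another eigenvalue on b. If both r and the latter
   vanished, the whole algebra would be nilpotent.

   If r <> 0, scale x to r = -1. As R_x is then invertible on the span of the R_a^k(a),
   k >= 1, x can be shifted so that [x, x] is a multiple of b. The left multiplication
   L_x satisfies L_x^2 = - R_x L_x on vectors killed by L_[x,x], so replacing a by an
   L_x-eigenvector near [x, a] diagonalises both actions at once: this gives R1 to R4,
   except when the eigenvalues 1 of L_x on a and on b collide, which gives R5. If r = 0,
   a similar shift kills [x, a] and leaves R6.

   For the absence of repetitions, two frames of one algebra span the same nilradical
   and so differ by a' = t a + s b + ..., b' = u b + ..., x' = c x + ...; comparing
   coefficients in the products gives equations between the structure constants. *)

(** The powers $R_a^k(a)$, $k \ge 1$, are right-annihilated because the Leibniz identity gives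
    $[y,[z,z]]=0$; polarised, it also puts $[x,a]+[a,x]$ in the right annihilator, which ties the
    left action of $x$ to the right one. After normalisation the few coefficients in [xproducts]
    therefore suffice, and a listed algebra is recognised by a frame with its constants. For the
    listed algebras themselves the Leibniz identity cannot be presupposed, so their full
    multiplication table is recorded and the identity is checked on frame vectors.

    The families are separated by resonances. On $b$ the left eigenvalue of $x$ is zero or opposite
    to the right one. In the first case, if the right eigenvalue is $1-n$, $R_x$ may have a Jordan
    block joining $b$ to the last vector of the chain: this is R3. A block of $L_x$ joining $a$ to
    $b$ gives R5. A nonzero block can be scaled to 1 but not removed.

    Indices are arranged with $n = m+2$, so that $e_1, e_3, \dots, e_n$ become [chain a 0], ...,
    [chain a m]. *)

Section LinearCombinations.
Variables (K : nzRingType) (V : lmodType K).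

(** Reified linear combinations: a vector identity with symbolic coefficients becomes one scalar
    identity per atom, within reach of [ring]. *)
Inductive lincomb : Type :=
  | LVar of nat
  | LZero
  | LAdd of lincomb & lincomb
  | LOpp of lincomb
  | LScale of K & lincomb.

Fixpoint lin_eval (env : seq V) (t : lincomb) : V :=
  match t with
  | LVar i => env`_i
  | LZero => 0
  | LAdd s t => lin_eval env s + lin_eval env t
  | LOpp t => - lin_eval env t
  | LScale c t => c *: lin_eval env t
  end.

Fixpoint lin_coef (i : nat) (t : lincomb) : K :=
  match t with
  | LVar j => if i == j then 1 else 0
  | LZero => 0
  | LAdd s t => lin_coef i s + lin_coef i t
  | LOpp t => - lin_coef i t
  | LScale c t => c * lin_coef i t
  end.

Lemma lin_evalE env t :
  lin_eval env t = \sum_(i < size env) lin_coef i t *: env`_i.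
Proof.
elim: t => [j||s IHs t IHt|t IHt|c t IHt] /=; rewrite ?IHs ?IHt.
- case: (ltnP j (size env)) => hj.
    rewrite (bigD1 (Ordinal hj)) //= eqxx scale1r big1 ?addr0 // => i.
    by rewrite -val_eqE /= => /negPf ->; rewrite scale0r.
  rewrite nth_default // big1 // => i _.
  by case: eqP (ltn_ord i) => [->|_ _]; rewrite ?scale0r // ltnNge hj.
- by rewrite big1 // => i _; rewrite scale0r.
- by rewrite -big_split; apply: eq_bigr => i _; rewrite scalerDl.
- by rewrite -sumrN; apply: eq_bigr => i _; rewrite scaleNr.
- by rewrite scaler_sumr; apply: eq_bigr => i _; rewrite scalerA.
Qed.

(** The premise is a [foldr] over a concrete [iota], so that simplification unfolds it into one
    conjunct per atom. *)
Lemma lin_eval_eq env s t :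
  foldr (fun i P => lin_coef i s = lin_coef i t /\ P) True (iota 0 (size env)) ->
  lin_eval env s = lin_eval env t.
Proof.
move=> h; rewrite !lin_evalE; apply: eq_bigr => i _; congr (_ *: _).
have : (i : nat) \in iota 0 (size env) by rewrite mem_iota /=.
elim: (iota _ _) h => //= j r IH [hj hr].
by rewrite inE => /predU1P[->|/(IH hr)].
Qed.

(** For scalar goals that hold only modulo a relation [l = r]: the multiplier [c] is the certificate
    left to [ring]. *)
Lemma eq_comb (c l r y z : K) : l = r -> y - z = c * (l - r) -> y = z.
Proof. by move=> ->; rewrite subrr mulr0 => /eqP; rewrite subr_eq0 => /eqP. Qed.

End LinearCombinations.

Ltac lin_index v env :=
  lazymatch env with
  | v :: _ => constr:(0%N)
  | _ :: ?r => let i := lin_index v r in constr:(i.+1)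
  end.

Ltac lin_insert v env :=
  let rec mem r :=
    lazymatch r with
    | nil => constr:(v :: env)
    | v :: _ => env
    | _ :: ?r' => mem r'
    end in
  mem env.

Ltac lin_atoms env t :=
  lazymatch t with
  | @GRing.add _ ?s ?u => let env' := lin_atoms env s in lin_atoms env' u
  | @GRing.opp _ ?s => lin_atoms env s
  | @GRing.scale _ _ _ ?s => lin_atoms env s
  | @GRing.zero _ => env
  | ?v => lin_insert v env
  end.

Ltac lin_reify K env t :=
  lazymatch t with
  | @GRing.add _ ?s ?u =>
      let s' := lin_reify K env s in let u' := lin_reify K env u in
      constr:(LAdd s' u')
  | @GRing.opp _ ?s => let s' := lin_reify K env s in constr:(LOpp s')
  | @GRing.scale _ _ ?c ?s =>
      let s' := lin_reify K env s in constr:(@LScale K c s')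
  | @GRing.zero _ => constr:(@LZero K)
  | ?v => let i := lin_index v env in constr:(@LVar K i)
  end.

(* Proves an identity between linear combinations of vectors up to one scalar
   identity per vector occurring in it. *)
Ltac lin_comb :=
  lazymatch goal with
  | K : numFieldType |- @eq ?T ?s ?t =>
      let env := lin_atoms (@nil T) s in
      let env := lin_atoms env t in
      let s' := lin_reify K env s in
      let t' := lin_reify K env t in
      apply: (@lin_eval_eq K _ env s' t'); rewrite /=; repeat split
  end.

(** * Sums of lines and free pairs *)

Section Subspaces.
Variables (K : fieldType) (V : vectType K).

Lemma memv_sum_lineP n (F : nat -> V) v :
  reflect (exists c : nat -> K, v = \sum_(i < n) c i *: F i)
          (v \in (\sum_(i < n) <[F i]>)%VS).
Proof.
apply: (iffP memv_sumP) => [[u hu ->]|[c ->]]; last first.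
  exists (fun i : 'I_n => c i *: F i) => // i _.
  by rewrite memvZ ?memv_line.
have /fin_all_exists[c hc] : forall i : 'I_n, exists c, u i = c *: F i.
  by move=> i; apply/vlineP/hu.
exists (fun i => if insub i is Some j then c j else 0).
by apply: eq_bigr => i _; rewrite valK hc.
Qed.

Lemma free_pair (u v : V) :
  free [:: u; v] -> forall c d, c *: u + d *: v = 0 -> c = 0 /\ d = 0.
Proof.
move=> fr c d h; have /freeP H : free (in_tuple [:: u; v]) := fr.
have {}H := H (fun i => if i == 0 :> nat then c else d).
have h0 : \sum_(i < 2) (if i == 0 :> nat then c else d) *: [:: u; v]`_i = 0.
  by rewrite !big_ord_recl big_ord0 /= addr0.
by split; [have := H h0 ord0 | have := H h0 ord_max].
Qed.

Lemma free_pairI (u v : V) :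
  (forall c d, c *: u + d *: v = 0 -> c = 0 /\ d = 0) -> free [:: u; v].
Proof.
move=> H; suff: free (in_tuple [:: u; v]) by []; apply/freeP => k.
rewrite !big_ord_recl big_ord0 /= addr0 => /H [h0 h1] i.
case: i => [[|[|//]] hi]; first by rewrite -h0; congr k; apply: val_inj.
by rewrite -h1; congr k; apply: val_inj.
Qed.

End Subspaces.

(** * Bilinear brackets and products of subspaces *)

Section Bilinear.
Variables (K : fieldType) (L : vectType K) (br : L -> L -> L).
Hypothesis bil : bilinear_bracket br.

Lemma brDl u v w : br (u + v) w = br u w + br v w.
Proof. by have := bil.1 w 1 u v; rewrite !scale1r. Qed.

Lemma brDr u v w : br u (v + w) = br u v + br u w.
Proof. by have := bil.2 u 1 v w; rewrite !scale1r. Qed.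

Lemma br0l w : br 0 w = 0.
Proof. by apply: (addIr (br 0 w)); rewrite -brDl !add0r. Qed.

Lemma br0r u : br u 0 = 0.
Proof. by apply: (addIr (br u 0)); rewrite -brDr !add0r. Qed.

Lemma brZl c u w : br (c *: u) w = c *: br u w.
Proof. by have := bil.1 w c u 0; rewrite br0l !addr0. Qed.

Lemma brZr c u w : br u (c *: w) = c *: br u w.
Proof. by have := bil.2 u c w 0; rewrite br0r !addr0. Qed.

Lemma brNl u w : br (- u) w = - br u w.
Proof. by rewrite -scaleN1r brZl scaleN1r. Qed.

Lemma brNr u w : br u (- w) = - br u w.
Proof. by rewrite -scaleN1r brZr scaleN1r. Qed.

Lemma br_suml n (F : 'I_n -> L) w :
  br (\sum_(i < n) F i) w = \sum_(i < n) br (F i) w.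
Proof.
apply: (big_morph (fun u => br u w)); last exact: br0l.
by move=> u v; exact: brDl.
Qed.

Lemma br_sumr n (F : 'I_n -> L) u :
  br u (\sum_(i < n) F i) = \sum_(i < n) br u (F i).
Proof.
apply: (big_morph (fun w => br u w)); last exact: br0r.
by move=> v w; exact: brDr.
Qed.

Definition brE :=
  (brDl, brDr, brZl, brZr, brNl, brNr, br0l, br0r, br_suml, br_sumr).

Lemma brv_sub (U V W : {vspace L}) :
  (forall u v, u \in U -> v \in V -> br u v \in W) -> (brv br U V <= W)%VS.
Proof.
move=> H; apply/span_subvP => _ /allpairsP[[u v] [/= hu hv ->]].
by apply: H; exact: vbasis_mem.
Qed.

Lemma mem_brv (U V : {vspace L}) u v :
  u \in U -> v \in V -> br u v \in brv br U V.
Proof.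
move=> hu hv; rewrite (coord_vbasis hu) (coord_vbasis hv).
rewrite (big_morph (fun u => br u _) (fun u v => brDl u v _) (br0l _)).
apply: memv_suml => i _; rewrite brZl memvZ //.
rewrite (big_morph _ (brDr _) (br0r _)).
apply: memv_suml => j _; rewrite brZr memvZ //; apply: memv_span.
by apply: allpairs_f; apply: mem_nth; rewrite size_tuple.
Qed.

Lemma lcsS N k : lcs br N k.+1 = brv br (lcs br N k) N.
Proof. by []. Qed.

Lemma derived_seriesS k :
  derived_series br k.+1 = brv br (derived_series br k) (derived_series br k).
Proof. by []. Qed.

End Bilinear.

(** * Consequences of the Leibniz identity *)

Section LeibnizIdentities.
Variables (K : fieldType) (L : vectType K) (br : L -> L -> L).
Hypothesis leib : leibniz_algebra br.
Let bil := leib.1.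

Lemma br_der y z x : br (br y z) x = br y (br z x) + br (br y x) z.
Proof. by rewrite leib.2 subrK. Qed.

Lemma br_sqr y x : br y (br x x) = 0.
Proof. by rewrite leib.2 subrr. Qed.

(** The expansion of $[y,[x,z]]$ is antisymmetric in $x, z$, so $[x,z]+[z,x]$ is always
    right-annihilated. *)
Lemma br_sym y x z : br y (br x z) = - br y (br z x).
Proof. by rewrite !leib.2 opprB. Qed.

End LeibnizIdentities.

(* In [F_n^2], [e_1 = chain e_1 0] and [e_{k+2} = chain e_1 k] for [k >= 1]. *)
Definition chain (L : Type) (br : L -> L -> L) (a : L) (k : nat) : L :=
  iter k (br^~ a) a.
Arguments chain : simpl never.

(** * Powers of a right multiplication and their filtration *)

Section Chains.
Variables (K : numFieldType) (L : vectType K) (br : L -> L -> L) (m : nat).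
Hypothesis bil : bilinear_bracket br.
Local Notation chain := (chain br).

Lemma chain0 a : chain a 0 = a. Proof. by []. Qed.

Lemma chainS a k : br (chain a k) a = chain a k.+1. Proof. by []. Qed.

Lemma chain_out a k : chain a m.+1 = 0 -> (m < k)%N -> chain a k = 0.
Proof.
move=> h0; elim: k => // k IH; rewrite ltnS leq_eqVlt => /predU1P[<- //|/IH].
by rewrite -chainS => ->; rewrite br0l.
Qed.

(** Always [m.+1] terms: once [chain a m.+1] vanishes the surplus ones are zero, and this is the
    span of all [chain a i] with [i >= k], a filtration shifted by $R_a$. *)
Definition tail a k : {vspace L} := (\sum_(j < m.+1) <[chain a (j + k)]>)%VS.

Lemma tailP a k v :
  reflect (exists c : nat -> K, v = \sum_(j < m.+1) c j *: chain a (j + k))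
          (v \in tail a k).
Proof. exact: (memv_sum_lineP m.+1 (fun j => chain a (j + k))). Qed.

Lemma mem_chain_tail a k i :
  chain a m.+1 = 0 -> (k <= i)%N -> chain a i \in tail a k.
Proof.
move=> h0 hk; case: (ltnP m i) => hi; first by rewrite (chain_out h0) ?mem0v.
have hik : (i - k < m.+1)%N by rewrite ltnS (leq_trans (leq_subr _ _)).
have := sumv_sup (Ordinal hik) (U := <[chain a i]>%VS)
  (Vs := fun j : 'I_m.+1 => <[chain a (j + k)]>%VS) (P := predT) isT.
by rewrite /= subnK // => /(_ (subvv _)) /subvP; apply; exact: memv_line.
Qed.

Lemma tail_le a k l : chain a m.+1 = 0 -> (k <= l)%N -> (tail a l <= tail a k)%VS.
Proof.
move=> h0 hkl; apply/subv_sumP => j _; rewrite -memvE.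
by rewrite mem_chain_tail // (leq_trans hkl) // leq_addl.
Qed.

Lemma tail_out a k : chain a m.+1 = 0 -> (m < k)%N -> tail a k = 0%VS.
Proof.
move=> h0 hk; apply/eqP; rewrite -subv0; apply/subv_sumP => j _.
by rewrite (chain_out h0) ?(leq_trans hk) ?leq_addl // -memvE mem0v.
Qed.

Lemma br_tail a k v : v \in tail a k -> br v a \in tail a k.+1.
Proof.
move=> /tailP[c ->]; rewrite (br_suml bil).
apply/tailP; exists c.
by apply: eq_bigr => j _; rewrite (brZl bil) addnS.
Qed.

Lemma tail1P a v : chain a m.+1 = 0 -> v \in tail a 1 ->
  exists c : nat -> K, v = \sum_(j < m) c j *: chain a j.+1.
Proof.
move=> h0 /tailP[c ->]; exists c; rewrite big_ord_recr /= addn1 h0 scaler0 addr0.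
by apply: eq_bigr => j _; rewrite addn1.
Qed.

Lemma sum_chain_tail a n k (c : 'I_n -> K) (f : 'I_n -> nat) :
  chain a m.+1 = 0 -> (forall j, (k <= f j)%N) ->
  \sum_(j < n) c j *: chain a (f j) \in tail a k.
Proof.
by move=> h0 hf; apply: memv_suml => j _; rewrite memvZ // mem_chain_tail.
Qed.

(** Serves to solve $[y,a]=[x,a]$ for $y$ in the nilradical, so that $x-y$ kills $a$ from the
    left. *)
Lemma tail_preimage a k v : chain a m.+1 = 0 -> v \in tail a k.+1 ->
  exists2 y, y \in tail a k & br y a = v.
Proof.
move=> h0 /tailP[c ->]; exists (\sum_(j < m.+1) c j *: chain a (j + k)).
  by apply/tailP; exists c.
rewrite (br_suml bil).
by apply: eq_bigr => j _; rewrite (brZl bil) addnS.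
Qed.

End Chains.

(** * Bases adapted to the nilradical *)

Section Frames.
Variables (K : numFieldType) (L : vectType K) (br : L -> L -> L) (m : nat).
Hypothesis bil : bilinear_bracket br.
Local Notation chain := (chain br).
Local Notation tail := (tail br m).

(* For [m >= 1] these relations make [b] and the [chain a k], [k <= m], a basis of a
   copy of [F_{m+2}^2]: independence follows by applying [R_a] repeatedly. *)
Definition F2_pair (a b : L) : Prop :=
  [/\ chain a m.+1 = 0, br a b = 0, br b a = 0, br b b = 0 &
      free [:: b; chain a m]].

Definition F2_span (a b : L) : {vspace L} := (<[a]> + <[b]> + tail a 1)%VS.

Lemma F2_spanP a b v :
  reflect (exists c d w, w \in tail a 1 /\ v = c *: a + d *: b + w)
          (v \in F2_span a b).
Proof.
apply: (iffP memv_addP) => [[u /memv_addP[y /vlineP[c ->]]]|].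
  by move=> [z /vlineP[d ->] ->] [w hw ->]; exists c, d, w.
move=> [c [d [w [hw ->]]]]; exists (c *: a + d *: b); last by exists w.
by rewrite memv_add // memvZ // memv_line.
Qed.

Section OnePair.
Variables a b : L.
Hypothesis ab : F2_pair a b.
Let a0 : chain a m.+1 = 0. Proof. by case: ab. Qed.
Let frb : free [:: b; chain a m]. Proof. by case: ab. Qed.

Lemma chain_top_neq0 : chain a m != 0.
Proof.
apply/eqP => h; have [] := free_pair frb (c := 0) (d := 1).
  by rewrite h scaler0 scale0r addr0.
by move=> _ /eqP; rewrite oner_eq0.
Qed.

(** Applying $R_a$ moves the leading vector up the chain until it is the top one, where the tail is
    zero. *)
Lemma chain_lead k c w : (k <= m)%N -> w \in tail a k.+1 ->
  c *: chain a k + w = 0 -> c = 0.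
Proof.
move=> hk; have [l hl] : exists l, (k + l = m)%N.
  by exists (m - k)%N; rewrite subnKC.
elim: l k w hk hl => [|l IH] k w hk hl hw h.
  move: hl hw h; rewrite addn0 => ->; rewrite (tail_out bil a0) // memv0 => /eqP ->.
  by rewrite addr0 => /eqP; rewrite scaler_eq0 (negPf chain_top_neq0) orbF => /eqP.
apply: (IH k.+1 (br w a)); rewrite ?addSnnS //.
- by rewrite -hl addnS ltnS leq_addr.
- exact: br_tail bil _ _ _ hw.
- by rewrite -chainS -(brZl bil) -(brDl bil) h br0l.
Qed.

(** $R_a$ removes [b] and shifts the chain, so the coefficients below the top vanish one by one; the
    top vector dies under $R_a$ too, and is left to the assumed freeness of [b] and [chain a m]. *)
Lemma chain_indep d (c : nat -> K) :
  d *: b + \sum_(k < m.+1) c k *: chain a k = 0 ->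
  d = 0 /\ forall k, (k < m.+1)%N -> c k = 0.
Proof.
move=> h; have hc k : (k < m)%N -> c k = 0.
  elim/ltn_ind: k => k IH hk.
  have := congr1 (br^~ a) h; rewrite (br0l bil) (brDl bil) (brZl bil).
  case: (ab) => _ _ -> _ _; rewrite scaler0 add0r.
  rewrite (br_suml bil).
  rewrite (bigD1 (Ordinal (ltnW hk : (k < m.+1)%N))) //= (brZl bil) chainS.
  apply: chain_lead => //; apply: memv_suml => j.
  rewrite -val_eqE /= (brZl bil) chainS => hj.
  case: (ltngtP j k) hj => // hjk _; last by rewrite memvZ // (mem_chain_tail bil).
  by rewrite IH ?scale0r ?mem0v // (ltn_trans hjk).
move: h; rewrite big_ord_recr big1 /= => [|i _]; last by rewrite hc ?scale0r.
rewrite add0r => /(free_pair frb)[-> hm]; split=> // k.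
by rewrite ltnS leq_eqVlt => /predU1P[->|/hc].
Qed.

Lemma sum_tail1_eq0 (c : nat -> K) :
  \sum_(j < m) c j *: chain a j.+1 = 0 -> forall j, (j < m)%N -> c j = 0.
Proof.
move=> h j hj.
have [] := chain_indep (d := 0) (c := fun k => if k is j.+1 then c j else 0).
  by rewrite scale0r add0r big_ord_recl scale0r add0r.
by move=> _ /(_ j.+1 hj).
Qed.

Lemma F2_span_indep c d w : w \in tail a 1 -> c *: a + d *: b + w = 0 ->
  [/\ c = 0, d = 0 & w = 0].
Proof.
move=> hw h; have [f fE] := tail1P a0 hw.
have [] := chain_indep (d := d) (c := fun k => if k is j.+1 then f j else c).
  by rewrite big_ord_recl /= -fE addrCA addrA.
move=> -> H; split=> //; first by apply: (H 0%N).
by rewrite fE big1 // => i _; rewrite (H i.+1) ?scale0r // ltnS.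
Qed.

Lemma F2_span_inj c d w c' d' w' : w \in tail a 1 -> w' \in tail a 1 ->
  c *: a + d *: b + w = c' *: a + d' *: b + w' -> [/\ c = c', d = d' & w = w'].
Proof.
move=> hw hw' h.
have [] := @F2_span_indep (c - c') (d - d') (w - w').
- exact: memvB.
- suff: (c - c') *: a + (d - d') *: b + (w - w')
      = (c *: a + d *: b + w) - (c' *: a + d' *: b + w').
    by rewrite h subrr.
  lin_comb; ring.
by move=> /eqP + /eqP + /eqP; rewrite !subr_eq0 => /eqP-> /eqP-> /eqP->.
Qed.

Lemma mem_a : a \in F2_span a b.
Proof. by rewrite memvE /F2_span -addvA addvSl. Qed.

Lemma mem_b : b \in F2_span a b.
Proof. by rewrite memvE (subv_trans (addvSr <[a]> _)%VS) // addvSl. Qed.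

Lemma tail1_sub : (tail a 1 <= F2_span a b)%VS.
Proof. exact: addvSr. Qed.

Lemma mem_chain k : chain a k \in F2_span a b.
Proof.
case: k => [|k]; first exact: mem_a.
by apply: (subvP tail1_sub); rewrite mem_chain_tail.
Qed.

Lemma sum_chain_mem n (c : 'I_n -> K) (f : 'I_n -> nat) :
  \sum_(j < n) c j *: chain a (f j) \in F2_span a b.
Proof. by apply: memv_suml => j _; rewrite memvZ // mem_chain. Qed.

End OnePair.
End Frames.

(** * Linear maps defined on coordinate rows *)

Section RowHom.
Variables (K : fieldType) (L : vectType K) (n : nat) (G : nat -> L).

Definition row_comb (u : 'rV[K]_n) : L := \sum_(i < n) u 0 i *: G i.+1.

Fact row_comb_linear : linear row_comb.
Proof.
move=> c u v; rewrite /row_comb scaler_sumr -big_split; apply: eq_bigr => i _.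
by rewrite !mxE scalerDl scalerA.
Qed.

HB.instance Definition _ := GRing.isLinear.Build K 'rV[K]_n L _ row_comb
  row_comb_linear.

Definition row_hom : 'Hom('rV[K]_n, L) := linfun row_comb.

Lemma row_homE u : row_hom u = \sum_(i < n) u 0 i *: G i.+1.
Proof. by rewrite lfunE. Qed.

Lemma row_hom_e i : (i < n)%N -> row_hom (e K n i.+1) = G i.+1.
Proof.
move=> hi; rewrite row_homE (bigD1 (Ordinal hi)) //= mxE eqxx scale1r big1.
  by rewrite addr0.
by move=> j; rewrite -val_eqE mxE eqSS /= => /negPf ->; rewrite scale0r.
Qed.

Lemma row_hom_ker : (forall u, row_hom u = 0 -> u = 0) -> lker row_hom = 0%VS.
Proof.
move=> H; apply/eqP; rewrite -subv0; apply/subvP => u.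
by rewrite memv_ker memv0 => /eqP/H ->.
Qed.

Lemma row_hom_dim : lker row_hom = 0%VS -> \dim (limg row_hom) = n.
Proof.
move=> h; have := limg_ker_dim row_hom fullv.
by rewrite h capv0 dimv0 add0n dimvf /dim /= mul1n.
Qed.

Lemma row_hom_table t (br : L -> L -> L) :
  bilinear_bracket br ->
  (forall i j, (i < n)%N -> (j < n)%N ->
    row_hom (t i.+1 j.+1) = br (G i.+1) (G j.+1)) ->
  forall u v, row_hom (table_bracket t u v) = br (row_hom u) (row_hom v).
Proof.
move=> bil H u v; rewrite /table_bracket linear_sum !row_homE.
rewrite (big_morph (fun y => br y _) (fun _ _ => brDl bil _ _ _) (br0l bil _)).
apply: eq_bigr => i _; rewrite linear_sum /= (big_morph _ (brDr bil _) (br0r bil _)).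
apply: eq_bigr => j _.
by rewrite linearZ /= H // (brZl bil) (brZr bil) scalerA.
Qed.

End RowHom.

Lemma alg_iso_sym (K : fieldType) (U V : vectType K) bu bv :
  @alg_iso K U V bu bv -> alg_iso bv bu.
Proof.
move=> [f [kf imf fM]]; exists f^-1%VF.
have fK : cancel f f^-1%VF by apply: lker0_lfunK; rewrite kf.
have fKV v : f (f^-1%VF v) = v by apply: limg_lfunVK; rewrite imf memvf.
split.
- apply/eqP; rewrite -subv0; apply/subvP => v.
  by rewrite memv_ker memv0 => /eqP h; rewrite -(fKV v) h linear0.
- by apply/vspaceP => u; rewrite memvf -(fK u) memv_img ?memvf.
- by move=> u v; rewrite -{1}(fKV u) -{1}(fKV v) -fM fK.
Qed.

(** * Coordinates in a frame *)

Section FrameBasis.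
Variables (K : numFieldType) (L : vectType K) (br : L -> L -> L) (m : nat).
Hypothesis bil : bilinear_bracket br.
Local Notation chain := (chain br).
Local Notation tail := (tail br m).
Local Notation F2_pair := (F2_pair br m).
Local Notation F2_span := (F2_span br m).

(* The basis [e_1, e_2, ..., e_n, x] of the tables, with [n = m + 2]. *)
Definition frame_vec (a b x : L) (i : nat) : L :=
  if i == 1%N then a else if i == 2%N then b else
  if i == m.+3 then x else chain a (i - 2).

Lemma frame_vec_chain a b x j : (j < m)%N -> frame_vec a b x j.+3 = chain a j.+1.
Proof. by move=> hj; rewrite /frame_vec !eqSS (ltn_eqF hj) !subSS subn0. Qed.

Lemma frame_vec_last a b x : frame_vec a b x m.+3 = x.
Proof. by rewrite /frame_vec eqxx. Qed.

Lemma sum_frame_vec a b x (c : nat -> K) :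
  \sum_(i < m.+2) c i *: frame_vec a b x i.+1
  = c 0 *: a + c 1 *: b + \sum_(j < m) c j.+2 *: chain a j.+1.
Proof.
rewrite !big_ord_recl /= addrA; congr (_ + _); apply: eq_bigr => j _.
by rewrite frame_vec_chain.
Qed.

Lemma row_hom_F2 a b x u :
  row_hom m.+2 (frame_vec a b x) u
  = u 0 (inord 0) *: a + u 0 (inord 1) *: b
    + \sum_(j < m) u 0 (inord j.+2) *: chain a j.+1.
Proof.
rewrite row_homE -(sum_frame_vec a b x (fun i => u 0 (inord i))).
by apply: eq_bigr => i _; rewrite inord_val.
Qed.

Lemma row_hom_frame a b x u :
  row_hom m.+3 (frame_vec a b x) u
  = u 0 (inord 0) *: a + u 0 (inord 1) *: b
    + \sum_(j < m) u 0 (inord j.+2) *: chain a j.+1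
    + u 0 (inord m.+2) *: x.
Proof.
rewrite row_homE -(sum_frame_vec a b x (fun i => u 0 (inord i))).
rewrite big_ord_recr /= frame_vec_last; congr (_ + _ *: _).
  by apply: eq_bigr => i _; rewrite -[X in u 0 X](inord_val _).
by rewrite -[X in u 0 X](inord_val _).
Qed.

Section Pair.
Variables a b : L.
Hypothesis ab : F2_pair a b.
Let a0 : chain a m.+1 = 0. Proof. by case: ab. Qed.

Lemma row_hom_F2_ker x : lker (row_hom m.+2 (frame_vec a b x)) = 0%VS.
Proof.
apply: row_hom_ker => u; rewrite row_hom_F2 => h.
have hw : \sum_(j < m) u 0 (inord j.+2) *: chain a j.+1 \in tail a 1.
  exact: (@sum_chain_tail _ _ _ _ bil _ m _ (fun j => u 0 (inord j.+2)) _ a0).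
have [h0 h1 h2] := F2_span_indep bil ab hw h.
have h3 := sum_tail1_eq0 bil ab (c := fun j => u 0 (inord j.+2)) h2.
apply/rowP => i; rewrite mxE -(inord_val i).
case: i => [[|[|i]] hi] //=; exact: h3.
Qed.

Lemma row_hom_F2_img x : limg (row_hom m.+2 (frame_vec a b x)) = F2_span a b.
Proof.
apply/vspaceP => v; apply/memv_imgP/F2_spanP => [[u _ ->]|[c [d [w [hw ->]]]]].
  rewrite row_hom_F2; do 3 eexists; split; last by [].
  exact: (@sum_chain_tail _ _ _ _ bil _ m _ (fun j => u 0 (inord j.+2)) _ a0).
have [f ->] := tail1P a0 hw.
exists (\row_i (if i : nat is i'.+1 then if i' is j.+1 then f j else d else c)).
  exact: memvf.
rewrite row_hom_F2 !mxE !inordK //; congr (_ + _); apply: eq_bigr => j _.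
by rewrite mxE inordK // !ltnS.
Qed.

Lemma dim_F2_span : \dim (F2_span a b) = m.+2.
Proof. by rewrite -(row_hom_F2_img 0) row_hom_dim ?row_hom_F2_ker. Qed.

Variable x : L.
Hypotheses (dimL : \dim {:L} = m.+3) (xN : x \notin F2_span a b).

Lemma row_hom_frame_ker : lker (row_hom m.+3 (frame_vec a b x)) = 0%VS.
Proof.
apply: row_hom_ker => u; rewrite row_hom_frame => h.
set z := u 0 (inord m.+2) in h.
have hw : \sum_(j < m) u 0 (inord j.+2) *: chain a j.+1 \in tail a 1.
  exact: (@sum_chain_tail _ _ _ _ bil _ m _ (fun j => u 0 (inord j.+2)) _ a0).
have hz : z = 0.
  apply/eqP; apply: contraNT xN => z0.
  move/eqP: h; rewrite addr_eq0 => /eqP h.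
  rewrite -(scalerK z0 x) -[z *: x]opprK memvZ // memvN -h.
  by apply/F2_spanP; do 3 eexists; split; first exact: hw.
rewrite hz scale0r addr0 in h.
have [h0 h1 h2] := F2_span_indep bil ab hw h.
have h3 := sum_tail1_eq0 bil ab (c := fun j => u 0 (inord j.+2)) h2.
apply/rowP => i; rewrite mxE -(inord_val i).
case: i => [[|[|i]] hi] //=; move: hi; rewrite !ltnS leq_eqVlt.
by case/predU1P => [->|/h3].
Qed.

Lemma row_hom_frame_img : limg (row_hom m.+3 (frame_vec a b x)) = fullv.
Proof.
apply/eqP; rewrite eqEdim subvf /= row_hom_dim ?dimL //; exact: row_hom_frame_ker.
Qed.

Lemma frame_spanP v : exists z n, n \in F2_span a b /\ v = z *: x + n.
Proof.
have: v \in limg (row_hom m.+3 (frame_vec a b x)) by rewrite row_hom_frame_img memvf.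
case/memv_imgP => u _ ->; rewrite row_hom_frame addrC; do 2 eexists; split; last by [].
apply/F2_spanP; do 3 eexists; split; last by [].
exact: (@sum_chain_tail _ _ _ _ bil _ m _ (fun j => u 0 (inord j.+2)) _ a0).
Qed.

Lemma frame_inj z n z' n' : n \in F2_span a b -> n' \in F2_span a b ->
  z *: x + n = z' *: x + n' -> z = z' /\ n = n'.
Proof.
move=> hn hn' h; have hz : z = z'.
  apply/eqP; rewrite -subr_eq0; apply: contraNT xN => z0.
  have -> : x = (z - z')^-1 *: (n' - n).
    apply: (canRL (scalerK z0)); rewrite scalerBl.
    have -> : z *: x = z' *: x + n' - n by rewrite -h addrK.
    by lin_comb; ring.
  by rewrite memvZ // memvB.
by split=> //; move: h; rewrite hz => /addrI.
Qed.

End Pair.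
End FrameBasis.

(** * Structure constants *)

(* The coefficients of [[a, x]], [[b, x]], [[x, b]] and [[x, x]] in the frame
   [a = e_1], [b = e_2], [x]: the suffix [_c] refers to the [chain a k], [k >= 1]. *)
Record xproducts (K : fieldType) := XProducts {
  ax_a : K; ax_b : K; ax_c : nat -> K;
  bx_b : K; bx_c : K; xb_b : K; xx_b : K; xx_c : K }.

Section Tables.
Variables (K : numFieldType) (L : vectType K) (br : L -> L -> L) (m : nat).
Hypothesis bil : bilinear_bracket br.
Local Notation chain := (chain br).
Local Notation tail := (tail br m).
Local Notation F2_pair := (F2_pair br m).
Local Notation F2_span := (F2_span br m).

(* [[x, a]] is minus the part of [[a, x]] outside the right annihilator. *)
Definition realizes (P : xproducts K) (a b x : L) : Prop :=
  [/\ br a x = ax_a P *: a + ax_b P *: b + \sum_(j < m) ax_c P j *: chain a j.+1,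
      br b x = bx_b P *: b + bx_c P *: chain a m,
      br x a = - (ax_a P *: a + ax_b P *: b),
      br x b = xb_b P *: b &
      br x x = xx_b P *: b + xx_c P *: chain a m].

(** The complete table on the frame: for a listed algebra it is available before the Leibniz
    identity, while in a Leibniz algebra it follows from the pair and [realizes]. *)
Record x_table (P : xproducts K) (a b x : L) : Prop := XTable {
  xt_pair : F2_pair a b;
  xt_cc : forall i j, br (chain a i) (chain a j.+1) = 0;
  xt_cb : forall i, br (chain a i) b = 0;
  xt_bc : forall i, br b (chain a i) = 0;
  xt_xc : forall j, br x (chain a j.+1) = 0;
  xt_cx : forall k, br (chain a k.+1) x = (ax_a P *+ k.+2) *: chain a k.+1
    + \sum_(j < m) ax_c P j *: chain a (k.+1 + j.+1);
  xt_x : realizes P a b x }.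

(* What the Leibniz identity imposes on the structure constants. *)
Definition consistent (P : xproducts K) : Prop :=
  [/\ forall j, ax_a P * ax_c P j = 0,
      ax_b P * (bx_b P + xb_b P) = 0 /\ ax_b P * bx_c P = 0,
      xb_b P * (bx_b P + xb_b P) = 0, xb_b P * bx_c P = 0 &
      xx_b P * xb_b P = 0].

Lemma x_table_of_leibniz P a b x :
  leibniz_algebra br -> F2_pair a b -> realizes P a b x -> x_table P a b x.
Proof.
move=> leib ab hx; have [a0 h1 h2 h3 _] := ab; have [hax hbx hxa hxb hxx] := hx.
(* The base case is a square; in the inductive step both terms of the expansion contain a bracket
   with [chain a k.+1] on the right. *)
have annr y k : br y (chain a k.+1) = 0.
  elim: k y => [|k IH] y; first by rewrite -chainS (br_sqr leib).
  by rewrite -chainS leib.2 !IH (br0l bil) subrr.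
have hcb i : br (chain a i) b = 0.
  by elim: i => // i IH; rewrite -chainS (br_der leib) IH h1 !(brE bil) addr0.
split=> //; first by case.
have hsum k : br (\sum_(j < m) ax_c P j *: chain a (k + j.+1)) a
    = \sum_(j < m) ax_c P j *: chain a (k.+1 + j.+1).
  by rewrite (br_suml bil); apply: eq_bigr => j _; rewrite (brZl bil).
have hsum0 y : br y (\sum_(j < m) ax_c P j *: chain a j.+1) = 0.
  by rewrite (br_sumr bil) big1 // => j _; rewrite (brE bil) annr scaler0.
elim=> [|k IH]; rewrite -[X in br X x]chainS (br_der leib) ?chain0.
  rewrite hax !((brDl bil), (brDr bil), (brZl bil), (brZr bil)) h1 h2 hsum0.
  by rewrite (hsum 0%N) -[br a a]/(chain a 1); lin_comb; ring.
rewrite IH hax !((brDl bil), (brDr bil), (brZl bil), (brZr bil)) hcb hsum0 hsum.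
by rewrite -[br (chain a k.+1) a]/(chain a k.+2); lin_comb; rewrite ?mulrS; ring.
Qed.

Section FromTable.
Variables (P : xproducts K) (a b x : L).
Hypotheses (tab : x_table P a b x) (dimL : \dim {:L} = m.+3).
Hypothesis xN : x \notin F2_span a b.
Let ab := xt_pair tab.
Let a0 : chain a m.+1 = 0. Proof. by case: ab. Qed.

(** Linear properties need checking on the frame only, with the whole chain as a single case. *)
Lemma frame_ind (S : L -> Prop) :
  (forall c u v, S u -> S v -> S (c *: u + v)) -> S 0 ->
  S a -> S b -> (forall j, S (chain a j.+1)) -> S x -> forall u, S u.
Proof.
move=> SD S0 Sa Sb Sc Sx u.
have [z [_ [/(F2_spanP br)[c [d [w [/(tail1P a0)[f ->] ->]]]] ->]]] :=
  frame_spanP bil ab dimL xN u.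
apply: (SD) => //; rewrite -addrA; apply: (SD) => //; apply: (SD) => //.
elim/big_rec: _ => // i v _; exact: SD.
Qed.

Lemma table_annr y j : br y (chain a j.+1) = 0.
Proof.
elim/frame_ind: y => [c u v hu hv||||k|].
- by rewrite !(brE bil) hu hv scaler0 addr0.
- by rewrite (brE bil).
- exact: (xt_cc tab 0).
- exact: (xt_bc tab).
- exact: (xt_cc tab).
- exact: (xt_xc tab).
Qed.

Lemma table_sum_annr y n (c : 'I_n -> K) (f : 'I_n -> nat) :
  br y (\sum_(j < n) c j *: chain a (f j).+1) = 0.
Proof.
by rewrite (br_sumr bil) big1 // => j _; rewrite (brZr bil) table_annr scaler0.
Qed.

Lemma table_br_b y : y \in F2_span a b -> br y b = 0.
Proof.
case/F2_spanP => c [d [_ [/(tail1P a0)[f ->] ->]]].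
case: ab => _ h1 h2 h3 _; rewrite !(brE bil) h1 h3 !scaler0 big1 ?addr0 // => j _.
by rewrite (brZl bil) (xt_cb tab) scaler0.
Qed.

Lemma table_ideal u v : u \in F2_span a b ->
  br u v \in F2_span a b /\ br v u \in F2_span a b.
Proof.
have [_ ab0 ba0 bb0 _] := ab; have [hax hbx hxa hxb hxx] := xt_x tab.
have memc := mem_chain bil ab; have ma := mem_a br m a b; have mb := mem_b br m a b.
have sumc (c : 'I_m -> K) (f : 'I_m -> nat) : \sum_(j < m) c j *: chain a (f j) \in F2_span a b.
  exact: (sum_chain_mem bil ab c f).
case/F2_spanP => c [d [_ [/(tail1P a0)[f ->] ->]]].
(* Five families suffice: [br w (chain a j.+1)] vanishes. *)
suff H w : [/\ br a w \in F2_span a b /\ br w a \in F2_span a b,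
    br b w \in F2_span a b /\ br w b \in F2_span a b &
    forall j, br (chain a j.+1) w \in F2_span a b].
  case: (H v) => -[H1 H2] [H3 H4] H5; rewrite !(brDl bil) !(brDr bil).
  rewrite !(brZl bil, brZr bil) table_sum_annr addr0; split; last first.
    by rewrite memvD ?memvZ.
  rewrite !memvD ?memvZ // (br_suml bil); apply: memv_suml => j _.
  by rewrite (brZl bil) memvZ.
elim/frame_ind: w => [k u1 u2 [[A1 A2] [A3 A4] A5] [[B1 B2] [B3 B4] B5]||||j|].
- by rewrite !(brDl bil, brDr bil, brZl bil, brZr bil); split=> [||j];
    rewrite ?(brDr bil) ?(brZr bil) ?memvD ?memvZ.
- by split=> [||j]; rewrite !(brE bil) mem0v.
- by split=> [||j]; rewrite ?ab0 ?ba0 ?mem0v // -?[br a a]/(chain a 1) ?chainS memc.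
- by split=> [||j]; rewrite ?ab0 ?ba0 ?bb0 ?(xt_cb tab) ?mem0v.
- split=> [||i]; rewrite ?table_annr ?mem0v ?chainS ?memc //.
  + by rewrite (xt_cb tab) mem0v.
- split=> [||j]; rewrite ?(xt_cx tab) ?hax ?hbx ?hxa ?hxb;
  try split; by rewrite ?memvN ?memvD ?memvZ ?memc ?ma ?mb ?sumc.
Qed.

End FromTable.
End Tables.

(** * The Leibniz identity from the table *)

Section TableAlgebra.
Variables (K : numFieldType) (L : vectType K) (br : L -> L -> L) (m : nat).
Hypotheses (bil : bilinear_bracket br) (m_gt0 : (0 < m)%N).
Local Notation chain := (chain br).
Local Notation tail := (tail br m).
Local Notation F2_pair := (F2_pair br m).
Local Notation F2_span := (F2_span br m).
Variables (P : xproducts K) (a b x : L).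
Hypotheses (tab : x_table br m P a b x) (dimL : \dim {:L} = m.+3).
Hypothesis xN : x \notin F2_span a b.
Let ab := xt_pair tab.
Let a0 : chain a m.+1 = 0. Proof. by case: ab. Qed.
Let annr := table_annr bil tab dimL xN.
Let ind := frame_ind bil tab dimL xN.
Let linE := (brDl bil, brDr bil, brZl bil, brZr bil, brNl bil, brNr bil).

(** By trilinearity frame vectors suffice. The right-hand side is antisymmetric in the last two
    arguments, so given [sym_a] and [sym_b] only the pairs $(a,x)$, $(b,x)$ and the vanishing of
    $[y,[x,x]]$ require work. The conditions in [consistent] all enter with $y = x$. *)
Lemma leibniz_of_table : consistent P -> leibniz_algebra br.
Proof.
move=> [k1 [k2 k3] k4 k5 k6]; split=> // y u z.
have [_ ab0 ba0 bb0 _] := ab; have [hax hbx hxa hxb hxx] := xt_x tab.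
have sum0 y' (c : 'I_m -> K) (f : 'I_m -> nat) :
    br y' (\sum_(j < m) c j *: chain a (f j).+1) = 0.
  exact: (table_sum_annr bil tab dimL xN).
have suma k : br (\sum_(j < m) ax_c P j *: chain a (k + j.+1)) a
    = \sum_(j < m) ax_c P j *: chain a (k.+1 + j.+1).
  by rewrite (br_suml bil); apply: eq_bigr => j _; rewrite (brZl bil).
have annr_x k y' : br y' (br (chain a k.+1) x) = 0.
  rewrite (xt_cx tab) (brDr bil) (brZr bil) annr scaler0 add0r.
  by under eq_bigr do rewrite addnS; rewrite sum0.
have topa : br (chain a m) a = 0 by rewrite chainS a0.
have annr_top y' : br y' (chain a m) = 0.
  by case: (m) m_gt0 => // k _; rewrite annr.
have xxx y' : br y' (br x x) = 0.
  rewrite hxx !linE annr_top scaler0 addr0.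
  elim/ind: y' => [c v w hv hw||||j|].
  - by rewrite !linE scalerDr scalerA mulrC -scalerA hv hw scaler0 addr0.
  - by rewrite (br0l bil) scaler0.
  - by rewrite ab0 scaler0.
  - by rewrite bb0 scaler0.
  - by rewrite (xt_cb tab) scaler0.
  - by rewrite hxb scalerA k6 scale0r.
have sym_a y' : br y' (br x a) = - br y' (br a x).
  by rewrite hxa hax (brNr bil) [in RHS](brDr bil) sum0 addr0.
have sym_b y' : br y' (br x b) = - br y' (br b x).
  rewrite hxb hbx !linE annr_top scaler0 addr0; apply/eqP.
  rewrite -addr_eq0 -scalerDl addrC; apply/eqP.
  elim/ind: y' => [c v w hv hw||||j|].
  - by rewrite !linE scalerDr scalerA mulrC -scalerA hv hw scaler0 addr0.
  - by rewrite (br0l bil) scaler0.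
  - by rewrite ab0 scaler0.
  - by rewrite bb0 scaler0.
  - by rewrite (xt_cb tab) scaler0.
  - by rewrite hxb scalerA mulrC k4 scale0r.
have jac_ax y' : br y' (br a x) = br (br y' a) x - br (br y' x) a.
  elim/ind: y' => [c v w hv hw||||j|].
  - by rewrite !linE hv hw; lin_comb; ring.
  - by rewrite !(br0l bil) subrr.
  - rewrite hax !linE -[br a a]/(chain a 1) ab0 ba0 (xt_cx tab) sum0 (suma 0%N).
    by lin_comb; ring.
  - by rewrite hax hbx !linE ba0 bb0 topa sum0 (br0l bil); lin_comb; ring.
  - rewrite hax !linE chainS !(xt_cx tab) !linE (xt_cb tab) suma sum0.
    by rewrite chainS; lin_comb; rewrite ?mulrS; ring.
  - rewrite hxa hxx !linE hax hbx !linE hxa hxb ba0 sum0 topa.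
    rewrite !scalerDr !scalerA k3 scaler_sumr big1 => [|j _].
      have -> : ax_b P * xb_b P = - (ax_b P * bx_b P).
        by apply/eqP; rewrite -addr_eq0 -mulrDr addrC k2.
      by lin_comb; ring.
    by rewrite scalerA k1 scale0r.
have jac_bx y' : br y' (br b x) = br (br y' b) x - br (br y' x) b.
  have jacN v : v \in F2_span a b -> br v (br b x) = br (br v b) x - br (br v x) b.
    move=> hv; have [hvx _] := table_ideal bil tab dimL xN x hv.
    rewrite (table_br_b bil tab hvx) hbx !linE annr_top (table_br_b bil tab hv).
    by rewrite (br0l bil); lin_comb; ring.
  have [k [v [hv ->]]] := frame_spanP bil ab dimL xN y'.
  rewrite !linE (jacN _ hv) [X in k *: br x X]hbx hxb hxx !linE hxb annr_top bb0.
  have -> : xb_b P *: br b x = (bx_b P * xb_b P) *: b.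
    by rewrite hbx scalerDr !scalerA k5 scale0r addr0 mulrC.
  by rewrite (xt_cb tab m); lin_comb; ring.
have bba y' : br (br y' b) a = 0.
  have [k [v [hv ->]]] := frame_spanP bil ab dimL xN y'.
  by rewrite !linE (table_br_b bil tab hv) hxb !linE ba0 (br0l bil) !scaler0 addr0.
have aab y' : br (br y' a) b = 0.
  have [_ h] := table_ideal bil tab dimL xN y' (mem_a br m a b).
  exact: (table_br_b bil tab h).
elim/ind: u => [c v w hv hw||||j|].
- by rewrite !linE hv hw; lin_comb; ring.
- by rewrite !(br0l bil) !(br0r bil) (br0l bil) subrr.
- elim/ind: z => [c v w hv hw||||j|]; last exact: jac_ax.
  + by rewrite !linE hv hw; lin_comb; ring.
  + by rewrite !(br0r bil) (br0l bil) subrr.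
  + by rewrite subrr (annr _ 0).
  + by rewrite ab0 (br0r bil) aab bba subrr.
  + by rewrite !annr (br0r bil) (br0l bil) subrr.
- elim/ind: z => [c v w hv hw||||j|]; last exact: jac_bx.
  + by rewrite !linE hv hw; lin_comb; ring.
  + by rewrite !(br0r bil) (br0l bil) subrr.
  + by rewrite ba0 (br0r bil) aab bba subrr.
  + by rewrite subrr bb0 (br0r bil).
  + by rewrite !annr (br0r bil) (br0l bil) subrr.
- rewrite !annr (br0l bil) subr0; elim/ind: z => [c v w hv hw||||k|].
  + by rewrite !linE hv hw scaler0 addr0.
  + by rewrite !(br0r bil).
  + by rewrite chainS annr.
  + by rewrite (xt_cb tab) (br0r bil).
  + by rewrite annr (br0r bil).
  + exact: annr_x.
- elim/ind: z => [c v w hv hw||||j|].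
  + by rewrite !linE hv hw; lin_comb; ring.
  + by rewrite !(br0r bil) (br0l bil) subrr.
  + by rewrite sym_a jac_ax opprB.
  + by rewrite sym_b jac_bx opprB.
  + by rewrite !annr (br0r bil) (br0l bil) subrr.
  + by rewrite subrr xxx.
Qed.
End TableAlgebra.

(** * Algebras with equal structure constants *)

Section TableMorphism.
Variables (K : numFieldType) (m : nat) (m_gt0 : (0 < m)%N).
Variables (L L' : vectType K) (br : L -> L -> L) (br' : L' -> L' -> L').
Hypotheses (bil : bilinear_bracket br) (bil' : bilinear_bracket br').
Variables (P : xproducts K) (a b x : L) (a' b' x' : L').
Hypotheses (tab : x_table br m P a b x) (tab' : x_table br' m P a' b' x').
Hypotheses (dimL : \dim {:L} = m.+3) (xN : x \notin F2_span br m a b).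
Variable f : 'Hom(L, L').
Hypotheses (fa : forall k, f (chain br a k) = chain br' a' k).
Hypotheses (fb : f b = b') (fx : f x = x').

Lemma x_table_morph u v : f (br u v) = br' (f u) (f v).
Proof.
have fE := (linearD, linearN, linearZ, linear0).
have fa0 : f a = a' by exact: (fa 0).
have fsum (c : 'I_m -> K) (g : 'I_m -> nat) :
  f (\sum_(j < m) c j *: chain br a (g j)) = \sum_(j < m) c j *: chain br' a' (g j).
  by rewrite linear_sum; apply: eq_bigr => j _; rewrite linearZ /= fa.
have [_ ab ba bb _] := xt_pair tab; have [_ ab' ba' bb' _] := xt_pair tab'.
have [e1 e2 e3 e4 e5] := xt_x tab; have [e1' e2' e3' e4' e5'] := xt_x tab'.
elim/(frame_ind bil tab dimL xN): u => [c u w hu hw||||i|].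
- by rewrite !(brDl bil) !(brZl bil) !fE /= hu hw (brDl bil') (brZl bil').
- by rewrite !(br0l bil) !fE (br0l bil').
- elim/(frame_ind bil tab dimL xN): v => [c u w hu hw||||j|].
  + by rewrite !(brDr bil) !(brZr bil) !fE /= hu hw (brDr bil') (brZr bil').
  + by rewrite !(br0r bil) !fE (br0r bil').
  + by rewrite fa0; exact: (fa 1).
  + by rewrite fa0 fb ab ab' fE.
  + by rewrite fa fa0 (xt_cc tab 0) (xt_cc tab' 0) fE.
  + by rewrite fa0 fx e1 e1' !fE /= fsum fa0 fb.
- elim/(frame_ind bil tab dimL xN): v => [c u w hu hw||||j|].
  + by rewrite !(brDr bil) !(brZr bil) !fE /= hu hw (brDr bil') (brZr bil').
  + by rewrite !(br0r bil) !fE (br0r bil').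
  + by rewrite fa0 fb ba ba' fE.
  + by rewrite fb bb bb' fE.
  + by rewrite fa fb (xt_bc tab) (xt_bc tab') fE.
  + by rewrite fb fx e2 e2' !fE /= fa fb.
- elim/(frame_ind bil tab dimL xN): v => [c u w hu hw||||j|].
  + by rewrite !(brDr bil) !(brZr bil) !fE /= hu hw (brDr bil') (brZr bil').
  + by rewrite !(br0r bil) !fE (br0r bil').
  + by rewrite fa fa0 chainS fa.
  + by rewrite fa fb (xt_cb tab) (xt_cb tab') fE.
  + by rewrite !fa (xt_cc tab) (xt_cc tab') fE.
  + by rewrite fa fx (xt_cx tab) (xt_cx tab') !fE /= fsum fa.
- elim/(frame_ind bil tab dimL xN): v => [c u w hu hw||||j|].
  + by rewrite !(brDr bil) !(brZr bil) !fE /= hu hw (brDr bil') (brZr bil').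
  + by rewrite !(br0r bil) !fE (br0r bil').
  + by rewrite fa0 fx e3 e3' !fE /= fa0 fb.
  + by rewrite fx fb e4 e4' !fE /= fb.
  + by rewrite fx fa (xt_xc tab) (xt_xc tab') fE.
  + by rewrite fx e5 e5' !fE /= fa fb.
Qed.

End TableMorphism.

(** * Solvability and nilradical from the table *)

Section TableStructure.
Variables (K : numFieldType) (L : vectType K) (br : L -> L -> L) (m : nat).
Hypotheses (bil : bilinear_bracket br) (m_gt0 : (0 < m)%N).
Local Notation chain := (chain br).
Local Notation tail := (tail br m).
Local Notation F2_pair := (F2_pair br m).
Local Notation F2_span := (F2_span br m).
Variables (P : xproducts K) (a b x : L).
Hypotheses (tab : x_table br m P a b x) (dimL : \dim {:L} = m.+3).
Hypothesis xN : x \notin F2_span a b.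
Let ab := xt_pair tab.
Let a0 : chain a m.+1 = 0. Proof. by case: ab. Qed.
Let annr := table_annr bil tab dimL xN.

Lemma table_annr_tail y w : w \in tail a 1 -> br y w = 0.
Proof.
case/(tail1P a0) => c ->; rewrite (br_sumr bil) big1 // => j _.
by rewrite (brZr bil) annr scaler0.
Qed.

(** Right multiplication by [b] and by the tail vanishes on the span, so only multiples of $R_a$
    remain and each product moves down the filtration. *)
Lemma table_br_F2 v u : v \in F2_span a b -> u \in F2_span a b ->
  exists c, br v u = c *: br v a.
Proof.
move=> hv /F2_spanP[c [d [w [hw ->]]]]; exists c.
rewrite !(brDr bil) !(brZr bil) (table_br_b bil tab hv) (table_annr_tail _ hw).
by rewrite scaler0 !addr0.
Qed.

Lemma table_br_a v : v \in F2_span a b -> br v a \in tail a 1.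
Proof.
case/F2_spanP => [c [d [w [hw ->]]]]; have [_ _ ba _ _] := ab.
rewrite !(brDl bil) !(brZl bil) ba scaler0 addr0 memvD //.
  by rewrite memvZ // -[br a a]/(chain a 1) (mem_chain_tail bil).
by apply: (subvP (tail_le bil a0 (leqnSn 1))); exact: br_tail.
Qed.

Lemma table_nilpotent : nilpotent_sub br (F2_span a b).
Proof.
exists m.+1; apply/eqP; rewrite -subv0 -(tail_out bil a0 (ltnSn m)).
suff H k : (lcs br (F2_span a b) k.+1 <= tail a k.+1)%VS by exact: H.
elim: k => [|k IH]; rewrite lcsS; apply: brv_sub => u v hu hv.
  by have [c ->] := table_br_F2 hu hv; rewrite memvZ // table_br_a.
have {}hu := subvP IH u hu.
have huN : u \in F2_span a b.
  apply: (subvP (tail1_sub br m a b)).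
  exact: (subvP (tail_le bil a0 (_ : 1 <= k.+1)%N)) hu.
by have [c ->] := table_br_F2 huN hv; rewrite memvZ // br_tail.
Qed.

Lemma table_br_mem u v : br u v \in F2_span a b.
Proof.
have idl := table_ideal bil tab dimL xN.
have [z [n [hn ->]]] := frame_spanP bil ab dimL xN u.
have [k [w [hw ->]]] := frame_spanP bil ab dimL xN v.
have [_ _ _ _ hxx] := xt_x tab.
rewrite (brDl bil) (brDr bil) !memvD //; last by case: (idl n (k *: x + w) hn).
  rewrite (brZl bil) (brZr bil) hxx !memvZ // memvD // memvZ ?mem_b //.
  exact: (mem_chain bil ab).
by case: (idl w (z *: x) hw).
Qed.

Lemma table_solvable : solvable_algebra br.
Proof.
(* $L^{[2]}$ lies in the span of the pair, $L^{[3]}$ in [tail a 1], which is right-annihilated. *)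
exists 3; apply/eqP; rewrite -subv0 derived_seriesS; apply: brv_sub => u v hu hv.
suff H : (derived_series br 2 <= tail a 1)%VS.
  by rewrite (table_annr_tail _ (subvP H _ hv)) mem0v.
rewrite derived_seriesS; apply: brv_sub => {u v hu hv}u v hu hv.
suff H : (derived_series br 1 <= F2_span a b)%VS.
  have [c ->] := table_br_F2 (subvP H _ hu) (subvP H _ hv).
  by rewrite memvZ // table_br_a // (subvP H).
by rewrite derived_seriesS; apply: brv_sub => *; exact: table_br_mem.
Qed.

(** A nilpotent ideal with an element $y$ outside the span would act by a nonzero scalar on some [v]
    killed by $R_a$: the top of the chain or [b]. Then [v] lies in the ideal and in all its lower
    central terms. *)
Lemma table_nilradical :
  ax_a P != 0 \/ bx_b P != 0 /\ bx_c P = 0 -> is_nilradical br (F2_span a b).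
Proof.
move=> nz; split; [|exact: table_nilpotent|].
  by move=> u v; exact: (table_ideal bil tab dimL xN).
move=> I idI [k nilI]; apply/subvP => y hy; apply/negPn/negP => yN.
have [z [n [hn Ey]]] := frame_spanP bil ab dimL xN y.
have z0 : z != 0 by apply: contraNneq yN => z0; rewrite Ey z0 scale0r add0r.
have [_ _ ba bb _] := ab; have [_ hbx _ _ _] := xt_x tab.
suff [v [c [v0 c0 vN va hv]]] : exists v c,
    [/\ v != 0, c != 0, v \in F2_span a b, br v a = 0 & br v x = c *: v].
  have hvy : v = (z * c)^-1 *: br v y.
    have [d hd] := table_br_F2 vN hn.
    rewrite Ey (brDr bil) (brZr bil) hv hd va scaler0 addr0 !scalerA.
    by rewrite mulVf ?scale1r // mulf_neq0.
  have vI : v \in I by rewrite hvy memvZ //; case: (idI y v hy).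
  suff H l : v \in lcs br I l by move: (H k); rewrite nilI memv0 (negPf v0).
  by elim: l => // l IH; rewrite lcsS hvy memvZ // mem_brv.
have [A0|[B0 C0]] := nz.
  exists (chain a m), (ax_a P *+ m.+1); split.
  - exact: chain_top_neq0 ab.
  - by rewrite -mulr_natr mulf_neq0 ?Num.Theory.pnatr_eq0.
  - exact: (mem_chain bil ab).
  - by rewrite chainS.
  - have [l ml] : exists l, m = l.+1 by exists m.-1; rewrite prednK.
    rewrite [in chain a m]ml (xt_cx tab) -ml big1 ?addr0 => [|j _]; first by rewrite ml.
    by rewrite (chain_out bil a0) ?scaler0 // addnS ltnS leq_addr.
exists b, (bx_b P); split=> //; last by rewrite hbx C0 scale0r addr0.
  apply: contra_neq (oner_neq0 K) => b0.
  by case: ab => _ _ _ _ /free_pair/(_ 1 0) []; rewrite ?b0 ?scaler0 ?scale0r ?addr0.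
exact: mem_b.
Qed.

End TableStructure.

(** * The listed algebras *)

Section TableBracket.
Variables (K : fieldType) (n : nat) (t : nat -> nat -> 'rV[K]_n).

Lemma table_bracket_bilinear : bilinear_bracket (table_bracket t).
Proof.
split=> [v c u w|u c v w]; rewrite /table_bracket scaler_sumr -big_split;
  apply: eq_bigr => i _; rewrite scaler_sumr -big_split; apply: eq_bigr => j _.
  by rewrite !mxE mulrDl scalerDl !scalerA mulrA.
by rewrite !mxE mulrDr scalerDl !scalerA mulrCA.
Qed.

Lemma table_bracket_e i j : (i < n)%N -> (j < n)%N ->
  table_bracket t (e K n i.+1) (e K n j.+1) = t i.+1 j.+1.
Proof.
move=> hi hj; rewrite /table_bracket (bigD1 (Ordinal hi)) //= (bigD1 (Ordinal hj)) //=.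
rewrite !mxE !eqxx mulr1 scale1r !big1 ?addr0 //.
  move=> k; rewrite -val_eqE /= => hk; rewrite big1 // => l _.
  by rewrite !mxE eqSS (negPf hk) mul0r scale0r.
by move=> k; rewrite -val_eqE /= => hk; rewrite !mxE eqSS (negPf hk) mulr0 scale0r.
Qed.

End TableBracket.

(** Since $e_{j+3}$ is [chain a j.+1], the parameters of [R6] are shifted by 3; [m.+2] is $n$. *)
Definition entry_xproducts (K : fieldType) (m : nat) (p : entry K) : xproducts K :=
  match p with
  | R1 a => XProducts (-1) 0 (fun=> 0) 0 0 0 a 0
  | R2 a => XProducts (-1) 0 (fun=> 0) a 0 0 0 0
  | R3 => XProducts (-1) 0 (fun=> 0) (1 - m.+2%:R) 1 0 0 0
  | R4 a => XProducts (-1) 0 (fun=> 0) (- a) 0 a 0 0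
  | R5 a => XProducts (-1) (- a) (fun=> 0) (-1) 0 1 0 0
  | R6 a l d => XProducts 0 0 (fun j => a j.+3) 1 0 d 0 l
  end.

Lemma sum_scale0 (K : pzRingType) (V : lmodType K) n (F : 'I_n -> V) :
  \sum_(j < n) (0 : K) *: F j = 0.
Proof. by rewrite big1 // => j _; rewrite scale0r. Qed.

Section ListedAlgebras.
Variables (K : numFieldType) (m : nat) (m_gt0 : (0 < m)%N) (p : entry K).
Local Notation br := (alg m.+2 p).
Local Notation E := (e K m.+3).
Local Notation chain := (chain br (E 1)).

Lemma alg_bilinear : bilinear_bracket br.
Proof. exact: table_bracket_bilinear. Qed.

Lemma alg_e i j : (i < m.+3)%N -> (j < m.+3)%N ->
  br (E i.+1) (E j.+1)
  = entry_table m.+2 p (gen_of m.+2 i.+1) (gen_of m.+2 j.+1).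
Proof. exact: table_bracket_e. Qed.

Lemma gen_of_E i : (i < m.+3)%N -> gen_of m.+2 i = (Defs.E i).
Proof. by move=> hi; rewrite /gen_of (ltn_eqF hi). Qed.

Lemma gen_of_X : gen_of m.+2 m.+3 = X.
Proof. by rewrite /gen_of eqxx. Qed.

Lemma alg_EE i j : (i < m.+2)%N -> (j < m.+2)%N ->
  br (E i.+1) (E j.+1) = F2_table K m.+2 m.+3 i.+1 j.+1.
Proof. by move=> hi hj; rewrite alg_e ?(leqW hi) ?(leqW hj) // !gen_of_E. Qed.

Lemma alg_EX i : (i < m.+2)%N ->
  br (E i.+1) (E m.+3) = products_with_x m.+2 p (Defs.E i.+1) X.
Proof. by move=> hi; rewrite alg_e ?(leqW hi) // gen_of_X gen_of_E. Qed.

Lemma alg_XE i : (i < m.+2)%N ->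
  br (E m.+3) (E i.+1) = products_with_x m.+2 p X (Defs.E i.+1).
Proof. by move=> hi; rewrite alg_e ?(leqW hi) // gen_of_X gen_of_E. Qed.

Lemma alg_XX : br (E m.+3) (E m.+3) = products_with_x m.+2 p X X.
Proof. by rewrite alg_e // gen_of_X. Qed.

Lemma alg_chain k : (k < m)%N -> chain k.+1 = E k.+3.
Proof.
elim: k => [|k IH] hk; first by rewrite -[chain 1]/(br (E 1) (E 1)) alg_EE.
by rewrite -chainS IH 1?ltnW // alg_EE ?ltnS 1?ltnW //= !ltnS hk.
Qed.

Lemma alg_chain_top : chain m = E m.+2.
Proof. by case: (m) m_gt0 (@alg_chain m.-1) => // k _ /= ->. Qed.

Lemma alg_chain_out : chain m.+1 = 0.
Proof.
rewrite -chainS alg_chain_top alg_EE //=.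
by case: (m) => //= k; rewrite ltnn.
Qed.

Lemma alg_chain0 k : (m < k)%N -> chain k = 0.
Proof. exact: (chain_out alg_bilinear alg_chain_out). Qed.

Lemma alg_F2_pair : F2_pair br m (E 1) (E 2).
Proof.
split; rewrite ?alg_EE //; first exact: alg_chain_out.
rewrite alg_chain_top; apply: free_pairI => c d /rowP h.
split; [have := h (inord 1) | have := h (inord m.+1)].
  rewrite !mxE inordK // eqxx mulr1 !eqSS.
  by rewrite (ltn_eqF m_gt0) mulr0 addr0.
rewrite !mxE inordK // eqxx mulr1 !eqSS.
by rewrite (gtn_eqF m_gt0) mulr0 add0r.
Qed.

Lemma alg_x_notin : E m.+3 \notin F2_span br m (E 1) (E 2).
Proof.
apply/negP => /F2_spanP[c [d [w [/(tail1P alg_chain_out)[f ->] /rowP h]]]].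
have := h ord_max; rewrite !mxE eqxx /= !mulr0 !add0r summxE big1.
  by move/eqP; rewrite oner_eq0.
move=> j _; rewrite alg_chain // !mxE /= !eqSS (gtn_eqF (ltn_ord j)).
by rewrite mulr0.
Qed.

Lemma alg_realizes : realizes br m (entry_xproducts m p) (E 1) (E 2) (E m.+3).
Proof.
have sumE (f : nat -> K) :
    \sum_(j < m) f j *: chain j.+1 = \sum_(j < m) f j *: E j.+3.
  by apply: eq_bigr => j _; rewrite alg_chain.
split; rewrite ?alg_XX ?alg_EX ?alg_XE ?alg_chain_top ?sumE //;
  case: (p) => [c|c||c|c|c l d] /=; rewrite ?sum_scale0 //; try by lin_comb; ring.
rewrite !scale0r !add0r -(big_mkord xpredT (fun j => c j.+3 *: E j.+3)).
by rewrite !big_add1.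
Qed.

(** The table sums over targets $e_j$, the chain formula over shifts; they match under $j \mapsto
    j-i-1$ with $i = k+3$, targets beyond $e_n$ counting as zero. *)
Lemma R6_row_sum (c : nat -> K) k :
  (if (k.+1 < m)%N
   then \sum_(k.+4 <= j < m.+3) c (j - k.+3 + 2)%N *: E j else 0)
  = \sum_(j < m) c j.+3 *: (if (k.+1 + j < m)%N then E (k.+4 + j) else 0).
Proof.
transitivity (\sum_(0 <= j < m - k.+1) c j.+3 *: E (k.+4 + j)).
  case: ltnP => hk; last by rewrite (eqP hk) big_geq.
  rewrite -{1}[k.+4]add0n big_addn !subSS; apply: eq_bigr => j _.
  by rewrite [(j + _)%N]addnC [X in c (X + _)%N](_ : _ = j.+1) ?addn2 // addSnnS addKn.
rewrite (big_nat_widen _ _ _ _ _ (leq_subr k.+1 m)) big_mkcond big_mkord.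
apply: eq_bigr => j _; rewrite andTb ltn_subRL addnC.
by rewrite addnC; case: ifP => // _; rewrite scaler0.
Qed.

Lemma alg_x_table : x_table br m (entry_xproducts m p) (E 1) (E 2) (E m.+3).
Proof.
split.
- exact: alg_F2_pair.
- move=> i j; case: (ltnP j m) => hj; last first.
    by rewrite [X in br _ X]alg_chain0 ?ltnS // (br0r alg_bilinear).
  rewrite [X in br _ X]alg_chain //; case: i => [|i]; first by rewrite alg_EE.
  case: (ltnP i m) => hi; last by rewrite alg_chain0 ?ltnS // (br0l alg_bilinear).
  by rewrite alg_chain // alg_EE.
- case=> [|i]; first by rewrite alg_EE.
  case: (ltnP i m) => hi; last by rewrite alg_chain0 ?ltnS // (br0l alg_bilinear).
  by rewrite alg_chain // alg_EE.
- case=> [|i]; first by rewrite alg_EE.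
  case: (ltnP i m) => hi; last by rewrite alg_chain0 ?ltnS // (br0r alg_bilinear).
  by rewrite alg_chain // alg_EE.
- move=> i.
  case: (ltnP i m) => hi; last by rewrite alg_chain0 ?ltnS // (br0r alg_bilinear).
  by rewrite alg_chain // alg_XE //; case: (p).
- move=> k; case: (ltnP k m) => hk; last first.
    rewrite alg_chain0 ?ltnS // (br0l alg_bilinear) scaler0 add0r big1 // => j _.
    by rewrite alg_chain0 ?scaler0 // addSn ltnS (leq_trans hk) ?leq_addr.
  have -> (f : nat -> K) : \sum_(j < m) f j *: chain (k.+1 + j.+1)
      = \sum_(j < m) f j *: (if (k.+1 + j < m)%N then E (k.+4 + j) else 0).
    apply: eq_bigr => j _; rewrite addnS; case: ltnP => hj.
      by rewrite alg_chain.
    by rewrite alg_chain0 ?ltnS.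
  rewrite alg_chain // alg_EX //.
  case: (p) => [c|c||c|c|c l d]; rewrite /= ?sum_scale0 ?addr0 ?ltnS ?hk ?subn1 ?mulNrn //.
  by rewrite R6_row_sum mul0rn scale0r add0r.
- exact: alg_realizes.
Qed.

End ListedAlgebras.

(** * Recognising a listed algebra from a frame *)

Section Recognition.
Variables (K : numFieldType) (m : nat) (m_gt0 : (0 < m)%N).

Lemma x_table_F2_iso (L : vectType K) (br : L -> L -> L) P (a b x : L) :
  bilinear_bracket br -> x_table br m P a b x ->
  iso_onto (@F2 K m.+2) br (F2_span br m a b).
Proof.
move=> bil tab; have ab := xt_pair tab; have [a0 ab0 ba0 bb0 _] := ab.
exists (row_hom m.+2 (frame_vec br m a b x)); split.
- exact: row_hom_F2_ker.
- exact: row_hom_F2_img.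
apply: row_hom_table => // i j.
case: i => [|[|i]] hi; case: j => [|[|j]] hj; rewrite /= ?linear0 ?frame_vec_chain //.
- rewrite row_hom_e ?frame_vec_chain //.
- by rewrite (xt_cc tab 0).
- by rewrite (xt_bc tab).
- rewrite chainS; case: ltnP => h; first by rewrite row_hom_e ?frame_vec_chain.
  by rewrite linear0 (chain_out bil a0).
- by rewrite (xt_cb tab).
- by rewrite (xt_cc tab).
Qed.

(** The basis map starts from coordinate rows, that is, from the listed algebra, and is then
    inverted. *)
Lemma x_table_alg_iso (p : entry K) (L : vectType K) (br : L -> L -> L) (a b x : L) :
  bilinear_bracket br -> \dim {:L} = m.+3 ->
  x_table br m (entry_xproducts m p) a b x -> x \notin F2_span br m a b ->
  alg_iso br (alg m.+2 p).
Proof.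
move=> bil dimL tab xN; apply: alg_iso_sym; have ab := xt_pair tab.
have a0 : chain br a m.+1 = 0 by case: ab.
exists (row_hom m.+3 (frame_vec br m a b x)); split.
- exact: row_hom_frame_ker.
- exact: row_hom_frame_img.
apply: (x_table_morph (alg_bilinear m p) bil (alg_x_table m_gt0 p) tab) => //.
- by rewrite dimvf /dim /= mul1n.
- exact: alg_x_notin.
- case=> [|k]; first by rewrite [LHS]row_hom_e.
  case: (ltnP k m) => hk; first by rewrite alg_chain // row_hom_e ?frame_vec_chain // !ltnS ltnW.
  by rewrite alg_chain0 // linear0 (chain_out bil a0).
- by rewrite row_hom_e.
- by rewrite row_hom_e ?frame_vec_last.
Qed.

Lemma dim_row : \dim {: 'rV[K]_m.+3} = m.+3.
Proof. by rewrite dimvf /dim /= mul1n. Qed.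

Lemma admissible_consistent (p : entry K) :
  admissible p -> consistent (entry_xproducts m p).
Proof.
case: p => [a|a||a|a|a l d] hp; (split; first by move=> j /=; ring) => /=; try ring;
  try by split; ring.
(* For [R6] the condition reads $\delta(1+\delta)=0$, whence the two values of $\delta$. *)
by case: hp => ->; ring.
Qed.

Lemma entry_nondegenerate (p : entry K) : let P := entry_xproducts m p in
  ax_a P != 0 \/ bx_b P != 0 /\ bx_c P = 0.
Proof.
by case: p => [a|a||a|a|a l d] /=; [left..|right]; rewrite ?oppr_eq0 ?oner_eq0.
Qed.

Lemma alg_leibniz (p : entry K) : admissible p -> leibniz_algebra (alg m.+2 p).
Proof.
move=> hp; apply: (leibniz_of_table (alg_bilinear m p) m_gt0 (alg_x_table m_gt0 p)).
- exact: dim_row.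
- exact: alg_x_notin.
- exact: admissible_consistent.
Qed.

Lemma alg_class (p : entry K) : admissible p ->
  [/\ leibniz_algebra (alg m.+2 p), solvable_algebra (alg m.+2 p) &
      has_nilradical_F2 m.+2 (alg m.+2 p)].
Proof.
move=> hp; have tab := alg_x_table m_gt0 p; have xN := alg_x_notin m_gt0 p.
split; first exact: alg_leibniz.
  exact: (table_solvable (alg_bilinear m p) tab dim_row xN).
exists (F2_span (alg m.+2 p) m (e K m.+3 1) (e K m.+3 2)); split.
  apply: (table_nilradical (alg_bilinear m p) m_gt0 tab dim_row xN).
  exact: entry_nondegenerate.
exact: (x_table_F2_iso (alg_bilinear m p) tab).
Qed.

(** The identity map respects equal tables. This covers coincidences such as [R1 0] and [R4 0]. *)
Lemma alg_eq (p q : entry K) :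
  entry_xproducts m p = entry_xproducts m q -> alg m.+2 p =2 alg m.+2 q.
Proof.
move=> hpq u v; have tq := alg_x_table m_gt0 q; rewrite -hpq in tq.
have := @x_table_morph _ _ _ _ _ _ (alg_bilinear m p) (alg_bilinear m q)
  _ _ _ _ _ _ _ (alg_x_table m_gt0 p) tq dim_row (alg_x_notin m_gt0 p) \1%VF.
move=> H; have {}H := H _ (id_lfunE _) (id_lfunE _).
rewrite -[LHS]id_lfunE -{2}[u]id_lfunE -{2}[v]id_lfunE; apply: H.
case=> [|k]; first by rewrite id_lfunE.
case: (ltnP k m) => hk; first by rewrite id_lfunE !alg_chain.
by rewrite !alg_chain0 // linear0.
Qed.

End Recognition.

(** * Completeness of the list *)

Section LeibnizPairs.
Variables (K : numFieldType) (L : vectType K) (br : L -> L -> L) (m : nat).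
Hypotheses (leib : leibniz_algebra br) (m_gt0 : (0 < m)%N).
Let bil := leib.1.
Local Notation chain := (chain br).
Local Notation tail := (tail br m).
Local Notation F2_pair := (F2_pair br m).
Local Notation F2_span := (F2_span br m).

Lemma br_chain y a k : br y (chain a k.+1) = 0.
Proof.
elim: k y => [|k IH] y; first by rewrite -chainS (br_sqr leib).
by rewrite -chainS leib.2 !IH (br0l bil) subrr.
Qed.

Section Pair.
Variables a b : L.
Hypothesis ab : F2_pair a b.
Let a0 : chain a m.+1 = 0. Proof. by case: ab. Qed.

Lemma br_tail1 y w : w \in tail a 1 -> br y w = 0.
Proof.
case/(tail1P a0) => c ->; rewrite (br_sumr bil) big1 // => j _.
by rewrite (brZr bil) br_chain scaler0.
Qed.

Lemma br_top y : br y (chain a m) = 0.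
Proof. by case: (m) m_gt0 => // k _; rewrite br_chain. Qed.

Lemma chain_br_b k : br (chain a k) b = 0.
Proof.
have [_ h _ _ _] := ab.
by elim: k => // k IH; rewrite -chainS (br_der leib) IH h !(brE bil) addr0.
Qed.

Lemma F2_br_b y : y \in F2_span a b -> br y b = 0.
Proof.
case/F2_spanP => c [d [_ [/(tail1P a0)[f ->] ->]]].
case: ab => _ h1 h2 h3 _; rewrite !(brE bil) h1 h3 !scaler0 big1 ?addr0 // => j _.
by rewrite (brZl bil) chain_br_b scaler0.
Qed.

Lemma F2_b_br y : y \in F2_span a b -> br b y = 0.
Proof.
case/F2_spanP => c [d [w [hw ->]]].
by case: ab => _ h1 h2 h3 _; rewrite !(brE bil) h2 h3 (br_tail1 _ hw) !scaler0 !addr0.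
Qed.

Lemma F2_br_lin y c d w : y \in F2_span a b -> w \in tail a 1 ->
  br y (c *: a + d *: b + w) = c *: br y a.
Proof.
move=> hy hw; rewrite !(brDr bil) !(brZr bil) (F2_br_b hy) (br_tail1 _ hw).
by rewrite scaler0 !addr0.
Qed.

Lemma F2_br_a y : y \in F2_span a b -> br y a \in tail a 1.
Proof.
case/F2_spanP => [c [d [w [hw ->]]]]; have [_ _ ba _ _] := ab.
rewrite !(brDl bil) !(brZl bil) ba scaler0 addr0 memvD //.
  by rewrite memvZ // -[br a a]/(chain a 1) (mem_chain_tail bil).
by apply: (subvP (tail_le bil a0 (leqnSn 1))); exact: br_tail.
Qed.

Lemma F2_br_mem y n : y \in F2_span a b -> n \in F2_span a b -> br y n \in tail a 1.
Proof.
move=> hy /F2_spanP[c [d [w [hw ->]]]].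
by rewrite (F2_br_lin _ _ hy hw) memvZ // F2_br_a.
Qed.

Lemma a_br_lin c d w : w \in tail a 1 ->
  br a (c *: a + d *: b + w) = c *: chain a 1.
Proof. by move=> hw; rewrite F2_br_lin // mem_a. Qed.

Lemma chain1_neq0 : chain a 1 != 0.
Proof.
apply/eqP => h; have /eqP := oner_neq0 K; apply.
by apply: (chain_lead bil ab m_gt0 (mem0v _)); rewrite h scaler0 addr0.
Qed.

Lemma chain_scale_inj k c d : (k <= m)%N -> c *: chain a k = d *: chain a k -> c = d.
Proof.
move=> hk h; apply/eqP; rewrite -subr_eq0; apply/eqP.
apply: (chain_lead bil ab hk (mem0v _)); rewrite addr0 scalerBl h; exact: subrr.
Qed.

(** $[a,v]=0$ removes the coefficient of [a], and $[v,a]=0$ all chain coefficients but the top one.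
    This bounds $[b,x]$, $[x,b]$, any other choice of [b], and, when $r = 0$, $[x,x]$. *)
Lemma F2_commuting v : v \in F2_span a b -> br v a = 0 -> br a v = 0 ->
  exists c d, v = c *: b + d *: chain a m.
Proof.
case/F2_spanP => c [d [w [hw ->]]] hva; rewrite a_br_lin // => /eqP.
rewrite scaler_eq0 (negPf chain1_neq0) orbF => /eqP c0.
move: hva; have [_ _ ba _ _] := ab.
rewrite c0 scale0r add0r (brDl bil) (brZl bil) ba scaler0 add0r.
have [f ->] := tail1P a0 hw; rewrite (br_suml bil).
under eq_bigr do rewrite (brZl bil) chainS.
move=> h; have hf j : (j.+1 < m)%N -> f j = 0.
  move=> hj; pose g k := if k is j.+2 then f j else 0.
  have [] := chain_indep bil ab (d := 0) (c := g).
    rewrite scale0r add0r; transitivity (\sum_(k < m.+2) g k *: chain a k).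
      by rewrite [RHS]big_ord_recr /= a0 scaler0 addr0.
    by rewrite !big_ord_recl !scale0r !add0r.
  by move=> _ /(_ j.+2 hj).
have hm : (m.-1 < m)%N by rewrite prednK.
exists d, (f m.-1); congr (_ + _).
rewrite (bigD1 (Ordinal hm)) //= prednK // big1 ?addr0 // => j.
rewrite -val_eqE /= => hj; rewrite hf ?scale0r // ltn_neqAle ltn_ord andbT.
by apply: contra_neq hj => hjm; rewrite -[LHS]/(j.+1.-1) hjm.
Qed.

(* On the span of the pair [R_a' = t R_a], since [R_b] and the [R_w] vanish there. *)
Lemma chain_change t s w a' k : w \in tail a 1 -> a' = t *: a + s *: b + w ->
  exists2 w', w' \in tail a k.+2 &
    chain a' k.+1 = t ^+ k.+2 *: chain a k.+1 + w'.
Proof.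
move=> hw Ea'; have ha' : a' \in F2_span a b.
  by rewrite Ea'; apply/F2_spanP; exists t, s, w.
have brR v : v \in F2_span a b -> br v a' = t *: br v a.
  by move=> hv; rewrite Ea' F2_br_lin.
elim: k => [|k [w' hw' IH]].
  exists (t *: br w a); first by rewrite memvZ // (br_tail bil).
  have [_ _ ba _ _] := ab.
  rewrite -[chain a' 1]/(br a' a') brR // Ea' !(brDl bil) !(brZl bil) ba.
  by rewrite -[br a a]/(chain a 1); lin_comb; ring.
exists (t *: br w' a); first by rewrite memvZ // (br_tail bil).
have hw'N : w' \in F2_span a b.
  apply: (subvP (tail1_sub br m a b)).
  exact: (subvP (tail_le bil a0 (_ : 1 <= k.+2)%N)) hw'.
rewrite -chainS IH (brDl bil) (brZl bil) brR ?(mem_chain bil ab) // brR // chainS.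
by rewrite scalerA mulrC -exprS.
Qed.

Lemma chain_change_top t s w a' : w \in tail a 1 -> a' = t *: a + s *: b + w ->
  chain a' m = t ^+ m.+1 *: chain a m /\ chain a' m.+1 = 0.
Proof.
move=> hw Ea'; split.
  have [w'] := chain_change m.-1 hw Ea'.
  by rewrite prednK // (tail_out bil a0) // memv0 => /eqP -> ->; rewrite addr0.
have [w'] := chain_change m hw Ea'.
by rewrite (tail_out bil a0) // memv0 a0 => /eqP -> ->; rewrite scaler0 addr0.
Qed.

End Pair.

Section IdealSpan.
Variables (N : {vspace L}) (a b : L).
Hypotheses (idN : ideal br N) (ab : F2_pair a b) (abN : F2_span a b = N).

Lemma F2_span_eq a' b' : F2_pair a' b' -> a' \in N -> b' \in N ->
  F2_span a' b' = N.
Proof.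
move=> ab' ha hb; apply/eqP; rewrite eqEdim -{2}abN !dim_F2_span // leqnn andbT.
rewrite !subv_add -!memvE ha hb /=; apply/subv_sumP => j _.
rewrite -memvE addn1; elim: (j : nat) => [|k IH]; first by case: (idN a' ha).
by rewrite -chainS; case: (idN a' IH).
Qed.

Lemma F2_pair_change_b u c : u != 0 -> let b' := u *: b + c *: chain a m in
  F2_pair a b' /\ F2_span a b' = N.
Proof.
move=> u0 b'; have ma := mem_a br m a b; have mb := mem_b br m a b.
have hb' : b' \in F2_span a b by rewrite memvD ?memvZ // (mem_chain bil ab).
suff ab' : F2_pair a b' by split=> //; apply: F2_span_eq; rewrite -?abN.
have [a0 h1 h2 h3 fr] := ab.
split=> //; rewrite /b' ?(brDr bil) ?(brZr bil) ?br_top ?(brDl bil) ?(brZl bil).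
- by rewrite h1 !scaler0 addr0.
- by rewrite h2 chainS a0 !scaler0 addr0.
- by rewrite h3 chain_br_b // !scaler0 !addr0 scaler0.
apply: free_pairI => d f h.
have [] := free_pair fr (c := d * u) (d := d * c + f).
  by rewrite -[RHS]h; lin_comb; ring.
by move=> /eqP; rewrite mulf_eq0 (negPf u0) orbF => /eqP ->; rewrite mul0r add0r.
Qed.

Lemma F2_pair_change_a t s w : t != 0 -> w \in tail a 1 ->
  let a' := t *: a + s *: b + w in F2_pair a' b /\ F2_span a' b = N.
Proof.
move=> t0 hw a'; have mb := mem_b br m a b.
have ha' : a' \in F2_span a b by apply/F2_spanP; exists t, s, w.
suff ab' : F2_pair a' b by split=> //; apply: F2_span_eq; rewrite -?abN.
have [a0 h1 h2 h3 fr] := ab.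
have [topE a0'] := chain_change_top ab hw (erefl a').
split=> //; [exact: (F2_br_b ab)|exact: (F2_b_br ab)|].
rewrite topE; apply: free_pairI => d f h.
have [] := free_pair fr (c := d) (d := f * t ^+ m.+1).
  by rewrite -[RHS]h; lin_comb; ring.
move=> -> /eqP; rewrite mulf_eq0 expf_eq0 (negPf t0) andbF orbF => /eqP ->.
by [].
Qed.

End IdealSpan.
End LeibnizPairs.

Section Completeness.
Variables (K : numFieldType) (L : vectType K) (br : L -> L -> L) (m : nat).
Variable N : {vspace L}.
Hypotheses (leib : leibniz_algebra br) (m_gt0 : (0 < m)%N).
Hypotheses (dimL : \dim {:L} = m.+3) (nilN : is_nilradical br N).
Let bil := leib.1.
Let idN : ideal br N. Proof. by case: nilN. Qed.
Local Notation chain := (chain br).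
Local Notation tail := (tail br m).
Local Notation F2_pair := (F2_pair br m).
Local Notation F2_span := (F2_span br m).

Definition frame_of (a b x : L) : Prop :=
  [/\ F2_pair a b, F2_span a b = N & x \notin N].

(** Normalisation changes frames inside the given algebra; the isomorphism is built only at the
    end. *)
Definition classified : Prop := exists (p : entry K) a b x,
  [/\ admissible p, frame_of a b x & realizes br m (entry_xproducts m p) a b x].

Lemma notin_shift c n x : c != 0 -> n \in N -> x \notin N -> c *: x + n \notin N.
Proof.
move=> c0 hn; apply: contra => h.
have -> : x = c^-1 *: (c *: x + n - n) by rewrite addrK scalerA mulVf ?scale1r.
by rewrite memvZ // memvB.
Qed.

Section Frame.
Variables a b x : L.
Hypothesis fr : frame_of a b x.
Let ab : F2_pair a b. Proof. by case: fr. Qed.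
Let abN : F2_span a b = N. Proof. by case: fr. Qed.
Let xN : x \notin F2_span a b. Proof. by rewrite abN; case: fr. Qed.
Let a0 : chain a m.+1 = 0. Proof. by case: ab. Qed.

Lemma memN_a : a \in N. Proof. by rewrite -abN mem_a. Qed.
Lemma memN_b : b \in N. Proof. by rewrite -abN mem_b. Qed.
Lemma memN_chain k : chain a k \in N. Proof. by rewrite -abN (mem_chain bil ab). Qed.

Lemma memN_tail k w : w \in tail a k.+1 -> w \in N.
Proof.
move=> hw; rewrite -abN; apply: (subvP (tail1_sub br m a b)).
exact: (subvP (tail_le bil a0 (_ : 1 <= k.+1)%N)) hw.
Qed.

Lemma decomp n : n \in N ->
  exists c d w, w \in tail a 1 /\ n = c *: a + d *: b + w.
Proof. by rewrite -abN => /F2_spanP. Qed.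

(** The $x$-coefficient of $[x,[x,x]]=0$ is the square of that of $[x,x]$. *)
Lemma xx_mem : br x x \in N.
Proof.
have [z [n [hn E]]] := frame_spanP bil ab dimL xN (br x x).
have h : br x (br x x) = 0 := br_sqr leib x x.
have hn0 : z *: n + br x n \in F2_span a b.
  by rewrite abN in hn *; rewrite memvD ?memvZ //; case: (idN x hn).
have h' : (z * z) *: x + (z *: n + br x n) = 0 *: x + 0.
  transitivity (br x (br x x)); last by rewrite h scale0r addr0.
  by rewrite [in RHS]E (brDr bil) (brZr bil) E scalerDr scalerA addrA.
have [/eqP] := frame_inj xN hn0 (mem0v _) h'.
by rewrite mulf_eq0 orbb => /eqP z0 _; rewrite E z0 scale0r add0r -abN.
Qed.

Lemma br_bx : exists c d, br b x = c *: b + d *: chain a m.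
Proof.
apply: (F2_commuting leib m_gt0 ab).
- by rewrite abN; case: (idN x memN_b).
- have [_ ab0 ba0 _ _] := ab.
  rewrite (br_der leib) ba0 (br0l bil) addr0; apply: (F2_b_br leib ab).
  by rewrite abN; case: (idN x memN_a).
- have [_ ab0 ba0 _ _] := ab.
  rewrite leib.2 ab0 (br0l bil) sub0r (F2_br_b leib ab) ?oppr0 //.
  by rewrite abN; case: (idN x memN_a).
Qed.

Lemma br_xb : exists c d, br x b = c *: b + d *: chain a m.
Proof.
apply: (F2_commuting leib m_gt0 ab).
- by rewrite abN; case: (idN x memN_b).
- have [_ ab0 ba0 _ _] := ab.
  rewrite (br_der leib) ba0 (br0r bil) add0r (F2_br_b leib ab) //.
  by rewrite abN; case: (idN x memN_a).
- have [_ ab0 ba0 _ _] := ab.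
  rewrite leib.2 ab0 (br0l bil) subr0 (F2_br_b leib ab) //.
  by rewrite abN; case: (idN x memN_a).
Qed.

Lemma br_chain_x c d w k : w \in tail a 1 -> br a x = c *: a + d *: b + w ->
  exists2 w', w' \in tail a k.+2 &
    br (chain a k.+1) x = (c *+ k.+2) *: chain a k.+1 + w'.
Proof.
move=> hw hax; have [_ ab0 ba0 _ _] := ab; elim: k => [|k [w' hw' IH]].
  exists (br w a); first exact: br_tail.
  rewrite -[chain a 1]/(br a a) (br_der leib) hax (a_br_lin leib ab _ _ hw).
  rewrite !(brDl bil) !(brZl bil) ba0 -[br a a]/(chain a 1).
  by lin_comb; ring.
exists (br w' a); first exact: br_tail.
rewrite -chainS (br_der leib) hax (F2_br_lin leib ab) ?(mem_chain bil ab) // IH.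
by rewrite !(brDl bil) !(brZl bil) chainS; lin_comb; rewrite ?mulrS; ring.
Qed.

Lemma br_top_x c d w : w \in tail a 1 -> br a x = c *: a + d *: b + w ->
  br (chain a m) x = (c *+ m.+1) *: chain a m.
Proof.
move=> hw hax; have [w'] := br_chain_x m.-1 hw hax.
by rewrite prednK // (tail_out bil a0) // memv0 => /eqP -> ->; rewrite addr0.
Qed.

Lemma br_tail_x c d w k v : w \in tail a 1 -> br a x = c *: a + d *: b + w ->
  v \in tail a k.+1 -> br v x \in tail a k.+1.
Proof.
move=> hw hax /tailP[f ->]; rewrite (br_suml bil); apply: memv_suml => j _.
rewrite (brZl bil) memvZ // addnS; have [w' hw' ->] := br_chain_x (j + k) hw hax.
rewrite memvD ?memvZ ?(mem_chain_tail bil) ?ltnS ?leq_addl //.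
by apply: (subvP (tail_le bil a0 _)) hw'; rewrite ltnS leqW ?leq_addl.
Qed.

Lemma br_tail_x_nil d w k v : w \in tail a 1 -> br a x = d *: b + w ->
  v \in tail a k.+1 -> br v x \in tail a k.+2.
Proof.
move=> hw hax /tailP[f ->]; rewrite (br_suml bil); apply: memv_suml => j _.
rewrite -[d *: b](add0r) -[0](scale0r a) in hax.
rewrite (brZl bil) memvZ // addnS; have [w' hw' ->] := br_chain_x (j + k) hw hax.
rewrite mul0rn scale0r add0r.
by apply: (subvP (tail_le bil a0 _)) hw'; rewrite !ltnS leq_addl.
Qed.

(** $R_x$ is triangular on the tail with diagonal entries $(k+2)c$, nonzero in characteristic zero:
    solve for the lowest coefficient and recurse on the remainder, [l] bounding the number of
    steps. *)
Lemma br_tail_x_surj c d w k v : c != 0 -> w \in tail a 1 ->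
  br a x = c *: a + d *: b + w ->
  v \in tail a k.+1 -> exists2 y, y \in tail a k.+1 & br y x = v.
Proof.
move=> c0 hw hax; have [l] : exists l, (m <= l + k)%N by exists m; rewrite leq_addr.
elim: l k v => [|l IH] k v hl hv.
  exists 0; first exact: mem0v.
  by move: hv; rewrite (tail_out bil a0) // memv0 => /eqP ->; rewrite (br0l bil).
have [f E] := tailP _ _ _ _ _ hv; rewrite big_ord_recl /= add0n in E.
set S := (X in _ = _ + X) in E.
have [w' hw' Ec] := br_chain_x k hw hax.
pose z := (f 0%N / (c *+ k.+2)).
have ck : c *+ k.+2 != 0 by rewrite -mulr_natr mulf_neq0 ?Num.Theory.pnatr_eq0.
have hr : v - br (z *: chain a k.+1) x \in tail a k.+2.
  have -> : v - br (z *: chain a k.+1) x = S - z *: w'.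
    by rewrite (brZl bil) Ec scalerDr scalerA divfK // E; lin_comb; ring.
  rewrite memvB ?memvZ //; apply: memv_suml => j _.
  by rewrite memvZ // (mem_chain_tail bil) // -[bump 0 j]/(j.+1) addSnnS leq_addl.
have [|y hy Ey] := IH k.+1 _ _ hr; first by rewrite addnS -addSn.
exists (z *: chain a k.+1 + y); last by rewrite (brDl bil) Ey addrC subrK.
rewrite memvD ?memvZ ?(mem_chain_tail bil) //.
exact: (subvP (tail_le bil a0 (leqnSn _))).
Qed.

(* Otherwise the whole algebra would be a nilpotent ideal. *)
Lemma nondegenerate c d w e f : w \in tail a 1 ->
  br a x = c *: a + d *: b + w -> br b x = e *: b + f *: chain a m ->
  c != 0 \/ e != 0.
Proof.
move=> hw hax hbx; case: eqP => [c0|]; last by left.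
case: eqP => [e0|]; last by right.
rewrite c0 scale0r add0r in hax; rewrite e0 scale0r add0r in hbx.
have spn := frame_spanP bil ab dimL xN.
suff h : (fullv <= N)%VS by move: xN; rewrite abN (subvP h) ?memvf.
case: nilN => _ _; apply; first by move=> u v _; split; exact: memvf.
(* With both diagonal entries zero, every right multiplication lowers the flag $L$, $N$, $\langle
   b\rangle$ plus [tail a 1], [tail a 1], [tail a 2], ... by one step. *)
have step0 u v : br u v \in N.
  have [z [n [hn ->]]] := spn u; have [y [n' [hn' ->]]] := spn v.
  rewrite abN in hn hn'; rewrite (brDl bil) (brDr bil) !memvD //.
  - by rewrite (brZl bil) (brZr bil) !memvZ // xx_mem.
  - by case: (idN (z *: x) hn').
  - by case: (idN (y *: x + n') hn).
have step1 u v : u \in N -> br u v \in (<[b]> + tail a 1)%VS.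
  move=> hu; have [y [n [hn ->]]] := spn v.
  rewrite (brDr bil) (brZr bil) memvD //; last first.
    by apply: (subvP (addvSr _ _)); rewrite (F2_br_mem leib ab) // abN.
  rewrite memvZ //; have [c' [d' [w' [hw' ->]]]] := decomp hu.
  rewrite !(brDl bil) !(brZl bil) hax hbx !memvD ?memvZ //.
  - by rewrite memv_add // memvZ ?memv_line.
  - by rewrite (subvP (addvSr _ _)) // (mem_chain_tail bil).
  - apply: (subvP (addvSr _ _)); apply: (subvP (tail_le bil a0 (leqnSn 1))).
    exact: (br_tail_x_nil hw hax).
have step2 u v : u \in (<[b]> + tail a 1)%VS -> br u v \in tail a 1.
  case/memv_addP => _ /vlineP[c' ->] [w' hw' ->]; have [y [n [hn ->]]] := spn v.
  have hu : c' *: b + w' \in N by rewrite memvD ?memvZ ?memN_b ?(memN_tail hw').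
  rewrite (brDr bil) memvD //; last by rewrite (F2_br_mem leib ab) // abN.
  rewrite (brZr bil) memvZ // (brDl bil) (brZl bil) hbx memvD ?memvZ //.
    exact: (mem_chain_tail bil).
  apply: (subvP (tail_le bil a0 (leqnSn 1))).
  exact: (br_tail_x_nil hw hax).
have step3 k u v : u \in tail a k.+1 -> br u v \in tail a k.+2.
  move=> hu; have [y [n [hn ->]]] := spn v.
  rewrite (brDr bil) (brZr bil) memvD ?memvZ ?(br_tail_x_nil hw hax) //.
  have [c' [d' [w' [hw' ->]]]] := F2_spanP _ _ _ _ _ hn.
  by rewrite (F2_br_lin leib ab) ?abN ?(memN_tail hu) // memvZ // br_tail.
exists m.+3; apply/eqP; rewrite -subv0 -(tail_out bil a0 (ltnSn m)).
suff H k : (lcs br fullv k.+3 <= tail a k.+1)%VS by exact: H.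
elim: k => [|k IH]; last first.
  by rewrite lcsS; apply: brv_sub => u v /(subvP IH) hu _; exact: step3.
rewrite lcsS; apply: brv_sub => u v + _; suff H : (lcs br fullv 2 <= <[b]> + tail a 1)%VS.
  by move=> /(subvP H); exact: step2.
rewrite lcsS; apply: brv_sub => {}u {}v + _; suff H : (lcs br fullv 1 <= N)%VS.
  by move=> /(subvP H); exact: step1.
by rewrite lcsS; apply: brv_sub.
Qed.

End Frame.

Lemma frame_change_x a b x c n :
  frame_of a b x -> c != 0 -> n \in N -> frame_of a b (c *: x + n).
Proof. by move=> [h1 h2 h3] c0 hn; split=> //; exact: notin_shift. Qed.

Lemma frame_change_b a b x u c :
  frame_of a b x -> u != 0 -> frame_of a (u *: b + c *: chain a m) x.
Proof.
by move=> [h1 h2 h3] u0; have [] := F2_pair_change_b leib m_gt0 idN h1 h2 c u0.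
Qed.

Lemma frame_change_a a b x t s w :
  frame_of a b x -> t != 0 -> w \in tail a 1 -> frame_of (t *: a + s *: b + w) b x.
Proof.
by move=> [h1 h2 h3] t0 hw; have [] := F2_pair_change_a leib m_gt0 idN h1 h2 s t0 hw.
Qed.

Let linE := (brDl bil, brDr bil, brZl bil, brZr bil, brNl bil, brNr bil).
(** The number of factors [a] in [chain a m]: the eigenvalue of $R_x$ there is $-M$ once
    $[a,x]=-a$. *)
Let M : K := m.+1%:R.
Let M_neq0 : M != 0. Proof. by rewrite Num.Theory.pnatr_eq0. Qed.

Lemma br_top_x_diag a b x : frame_of a b x -> br a x = - a ->
  br (chain a m) x = - M *: chain a m.
Proof.
move=> fr hax; have hax' : br a x = -1 *: a + 0 *: b + 0.
  by rewrite hax; lin_comb; ring.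
rewrite (br_top_x fr (mem0v _) hax'); congr (_ *: _).
by rewrite /M mulNrn.
Qed.

Lemma classified_R1 a b x g : frame_of a b x ->
  br a x = - a -> br x a = a -> br x b = 0 -> br b x = 0 -> br x x = g *: b ->
  classified.
Proof.
move=> fr hax hxa hxb hbx hxx; have [ab _ _] := fr; have [a0 ab0 ba0 bb0 _] := ab.
have [g0|g0] := eqVneq g 0.
  exists (R1 0), a, b, x; split; [by left|by []|].
  by split; rewrite /= ?hax ?hbx ?hxa ?hxb ?hxx ?sum_scale0 ?g0; lin_comb; ring.
exists (R1 1), a, (g *: b + 0 *: chain a m), x; split; first by right.
  exact: frame_change_b.
rewrite scale0r addr0.
by split; rewrite /= ?linE ?hax ?hbx ?hxa ?hxb ?hxx ?sum_scale0; lin_comb; ring.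
Qed.

Lemma classified_right_diag a b x g : frame_of a b x ->
  br a x = - a -> br x a = a -> br x b = 0 -> br x x = g *: b -> classified.
Proof.
move=> fr hax hxa hxb hxx; have [ab abN _] := fr; have [a0 ab0 ba0 bb0 _] := ab.
have htop := br_top_x_diag fr hax; have top0 := br_top leib m_gt0 a.
have topb := chain_br_b leib ab m.
have topa : br (chain a m) a = 0 by rewrite chainS.
have [c [d hbx]] := br_bx fr.
have [c0|c0] := eqVneq c 0.
  (* Adding $w$ times the top vector to [b] cancels $d$; the shift of [x] by $r$ times the top
     vector makes $[x,x]$ a multiple of the new [b]. *)
  have [w hd] : exists w, d = w * M by exists (d / M); rewrite divfK.
  have [r hr] : exists r, r * M = - (g * w) by exists (- (g * w) / M); rewrite divfK.
  apply: (@classified_R1 a (1 *: b + w *: chain a m) (1 *: x + r *: chain a m) g).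
  - apply: frame_change_b; rewrite ?oner_neq0 //.
    by apply: frame_change_x; rewrite ?oner_neq0 ?memvZ ?(memN_chain fr).
  - by rewrite !linE hax !top0; lin_comb; ring.
  - by rewrite !linE hxa topa; lin_comb; ring.
  - by rewrite !linE hxb !top0 topb; lin_comb; ring.
  - by rewrite !linE hbx htop !top0 c0 hd; lin_comb; ring.
  - rewrite !linE hxx !top0 htop; lin_comb; try ring.
    by apply: (eq_comb (c := -1) hr); ring.
(* Shifting [x] by $sb$ cancels $gb$ in $[x,x]$, and [r] the top term $sd$ thereby created. *)
have [s hs] : exists s, s * c = - g by exists (- g / c); rewrite divfK.
have [r hr] : exists r, r * M = s * d by exists (s * d / M); rewrite divfK.
pose x' := 1 *: x + (s *: b + r *: chain a m).
have fr' : frame_of a b x'.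
  by apply: frame_change_x; rewrite ?oner_neq0 ?memvD ?memvZ ?(memN_chain fr) ?(memN_b fr).
have hax' : br a x' = - a by rewrite !linE hax ab0 !top0; lin_comb; ring.
have hxa' : br x' a = a by rewrite !linE hxa ba0 topa; lin_comb; ring.
have hbx' : br b x' = c *: b + d *: chain a m.
  by rewrite !linE hbx bb0 !top0; lin_comb; ring.
have hxb' : br x' b = 0 by rewrite !linE hxb bb0 topb; lin_comb; ring.
have hxx' : br x' x' = 0.
  rewrite !linE hxx hxb bb0 hbx htop topb !top0; lin_comb; try ring.
    by apply: (eq_comb (c := -1) hr); ring.
  by apply: (eq_comb (c := 1) hs); ring.
have htop' := br_top_x_diag fr' hax'.
clearbody x'.
(* If $c \ne -M$, the vector $b$ plus $d/(c+M)$ times the top one is an eigenvector; otherwise a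
   Jordan block may persist. *)
have [cM|cM] := eqVneq c (- M); last first.
  have cM' : c + M != 0 by rewrite addr_eq0.
  have [w hw] : exists w, d = w * (c + M) by exists (d / (c + M)); rewrite divfK.
  exists (R2 c), a, (1 *: b + w *: chain a m), x'; split; first exact/eqP.
    by apply: frame_change_b; rewrite ?oner_neq0.
  split; rewrite /= ?linE ?hax' ?hbx' ?hxa' ?hxb' ?hxx' ?sum_scale0 ?htop' ?top0;
    by lin_comb; rewrite ?hw; ring.
have eM : 1 - m.+2%:R = - M by rewrite /M [in LHS]mulrS; ring.
have [d0|d0] := eqVneq d 0.
  exists (R2 c), a, b, x'; split; [exact/eqP|by []|].
  by split; rewrite /= ?hax' ?hbx' ?hxa' ?hxb' ?hxx' ?sum_scale0 ?d0; lin_comb; ring.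
exists R3, a, (d^-1 *: b + 0 *: chain a m), x'; split=> //.
  by apply: frame_change_b; rewrite ?invr_eq0.
rewrite scale0r addr0; have hd : d^-1 * d = 1 by rewrite mulVf.
split; rewrite /= ?linE ?hax' ?hbx' ?hxa' ?hxb' ?hxx' ?sum_scale0 ?eM ?cM;
  lin_comb; try ring.
by apply: (eq_comb (c := 1) hd); ring.
Qed.

(* If [[[x, x], u] = 0] then [[x, [x, u]] = - [[x, u], x]], so that left eigenvectors
   of [x] are also right eigenvectors. *)
Lemma left_right_eigen x u v : br (br x x) u = 0 -> br x u = u + v ->
  br u x = - (br x u + br x v + br v x).
Proof.
move=> h hu; have := leib.2 x x u; rewrite h sub0r hu !linE hu => /eqP.
rewrite -addr_eq0 => /eqP E; apply/eqP; rewrite -addr_eq0; apply/eqP.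
by rewrite -[RHS]E; lin_comb; ring.
Qed.

Lemma left_right_fixed x u : br (br x x) u = 0 -> br x u = u -> br u x = - u.
Proof.
move=> h hu; rewrite (@left_right_eigen x u 0) ?addr0 // (br0l bil) (br0r bil).
by rewrite !addr0 hu.
Qed.

Section LeftAction.
Variables (a b x : L) (d : K) (w : L).
Hypotheses (fr : frame_of a b x) (hw : w \in tail a 1).
Hypothesis hax : br a x = -1 *: a + d *: b + w.
Let ab : F2_pair a b. Proof. by case: fr. Qed.

(** Left multiplication by [a] reads off the coefficient of [a], and $[a,[x,a]]=-[a,[a,x]]$. *)
Lemma br_xa_decomp : exists f w', w' \in tail a 1 /\ br x a = 1 *: a + f *: b + w'.
Proof.
have [|c [f [w' [hw' E]]]] := decomp fr (n := br x a).
  by case: (idN x (memN_a fr)).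
have := br_sym leib a x a; rewrite hax E !(a_br_lin leib ab) // -scaleNr opprK.
by move/(chain_scale_inj leib ab m_gt0) => c1; exists f, w'; rewrite -c1.
Qed.

(** The new generator is $[x,a]$ itself: it differs from [a] by a vector that [x] kills from the
    left, so it is fixed by $L_x$. *)
Lemma classified_left_zero g : br x b = 0 -> br x x = g *: b -> classified.
Proof.
move=> hxb hxx; have [f [w' [hw' E]]] := br_xa_decomp.
have fr' := frame_change_a f fr (oner_neq0 K) hw'; rewrite -E in fr'.
have hxa : br x (br x a) = br x a.
  by rewrite [X in br x X]E !linE hxb (br_tail1 leib ab _ hw'); lin_comb; ring.
apply: (classified_right_diag fr' _ hxa hxb hxx).
have [[_ _ ba _ _] _ _] := fr'.
by apply: left_right_fixed => //; rewrite hxx (brZl bil) ba scaler0.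
Qed.

Lemma classified_left_nonzero c : c != 0 ->
  br x b = c *: b -> br b x = - c *: b -> br x x = 0 -> classified.
Proof.
move=> c0 hxb hbx hxx; have [f [w' [hw' E]]] := br_xa_decomp.
have [c1|c1] := eqVneq c 1; last first.
  have c1' : 1 - c != 0 by rewrite subr_eq0 eq_sym.
  (* $a + (f+s)b + w'$ is fixed by $L_x$ exactly when $f + (f+s)c = f+s$. *)
  have [s hs] : exists s, s * (1 - c) = f * c by exists (f * c / (1 - c)); rewrite divfK.
  have fr' := frame_change_a (f + s) fr (oner_neq0 K) hw'.
  set a' := 1 *: a + _ + _ in fr'; have [[_ ab' ba' bb' _] _ _] := fr'.
  have hxa : br x a' = a'.
    rewrite /a' !linE hxb E (br_tail1 leib ab _ hw'); lin_comb; try ring.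
    by apply: (eq_comb (c := -1) hs); ring.
  have hax' : br a' x = - a' by apply: left_right_fixed; rewrite ?hxx ?(br0l bil).
  clearbody a'; exists (R4 c), a', b, x; split=> //; first exact/eqP.
  by split; rewrite /= ?hax' ?hbx ?hxa ?hxb ?hxx ?sum_scale0; lin_comb; ring.
rewrite {}c1 scale1r in hxb hbx *; rewrite scaleN1r in hbx.
have fr' := frame_change_a f fr (oner_neq0 K) hw'.
set a' := 1 *: a + _ + _ in fr'; have [[_ ab' ba' bb' _] _ _] := fr'.
have hxa : br x a' = a' + f *: b.
  by rewrite /a' !linE hxb E (br_tail1 leib ab _ hw'); lin_comb; ring.
have hax' : br a' x = - a' - f *: b.
  rewrite (left_right_eigen _ hxa) ?hxx ?(br0l bil) //.
  by rewrite hxa !linE hxb hbx; lin_comb; ring.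
clearbody a'; have [f0|f0] := eqVneq f 0.
  exists (R5 0), a', b, x; split=> //; first by left.
  by split; rewrite /= ?hax' ?hbx ?hxa ?hxb ?hxx ?sum_scale0 ?f0; lin_comb; ring.
exists (R5 1), a', (f *: b + 0 *: chain a' m), x; split; first by right.
  exact: frame_change_b.
rewrite scale0r addr0.
by split; rewrite /= ?linE ?hax' ?hbx ?hxa ?hxb ?hxx ?sum_scale0; lin_comb; ring.
Qed.

End LeftAction.

Lemma classified_nonzero_normalized a b x d w g : frame_of a b x -> w \in tail a 1 ->
  br a x = -1 *: a + d *: b + w -> br x x = g *: b -> classified.
Proof.
move=> fr hw hax hxx; have [ab _ _] := fr.
have [c [f hxb]] := br_xb fr; have [a0 ab0 ba0 bb0 frb] := ab.
have htop := br_top_x fr hw hax; have top0 := br_top leib m_gt0 a.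
rewrite mulNrn -/M in htop.
have [c0|c0] := eqVneq c 0.
  apply: (classified_left_zero fr hw hax _ hxx); rewrite hxb c0.
  (* Expand $[x,[x,b]]$: the left side is zero since the top vector is right-annihilated, the right
     side is $fM$ times it. *)
  suff /eqP : f * M = 0.
    by rewrite mulf_eq0 (negPf M_neq0) orbF => /eqP ->; rewrite !scale0r addr0.
  apply: (chain_scale_inj leib ab (leqnn m)).
  have := leib.2 x x b; rewrite hxx hxb !linE bb0 hxb !top0 htop c0 => h.
  move: h; rewrite !scale0r !scaler0 !add0r scalerA mulrN scaleNr opprK.
  by move=> <-.
(* $[x,[x,x]]=0$ gives $gc=0$. *)
have g0 : g = 0.
  have := br_sqr leib x x; rewrite hxx (brZr bil) hxb scalerDr !scalerA.
  by case/(free_pair frb) => /eqP; rewrite mulf_eq0 (negPf c0) orbF => /eqP.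
rewrite g0 scale0r in hxx.
have [s hs] : exists s, s * c = f by exists (f / c); rewrite divfK.
have fr' := frame_change_b s fr (oner_neq0 K).
set b' := 1 *: b + _ in fr'.
have hxb' : br x b' = c *: b'.
  by rewrite /b' !linE hxb top0 -hs; lin_comb; ring.
have hw' : w - (d * s) *: chain a m \in tail a 1.
  by rewrite memvB // memvZ // (mem_chain_tail bil).
have hax' : br a x = -1 *: a + d *: b' + (w - (d * s) *: chain a m).
  by rewrite hax /b'; lin_comb; ring.
clearbody b'; apply: (classified_left_nonzero fr' hw' hax' c0 hxb' _ hxx).
have := leib.2 x x b'; rewrite hxx (br0l bil) sub0r hxb' (brZr bil) (brZl bil).
by rewrite -scalerN => /(scalerI c0); rewrite hxb' scaleNr => ->; rewrite opprK.
Qed.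

Lemma classified_nonzero a b x c d w : frame_of a b x -> w \in tail a 1 ->
  br a x = c *: a + d *: b + w -> c != 0 -> classified.
Proof.
move=> fr hw hax c0; have [ab abN _] := fr.
have k0 : - c^-1 != 0 by rewrite oppr_eq0 invr_eq0.
have {fr} fr := frame_change_x fr k0 (mem0v N).
set x1 := - c^-1 *: x + 0 in fr.
have hw1 : - c^-1 *: w \in tail a 1 by rewrite memvZ.
have hax1 : br a x1 = -1 *: a + (- c^-1 * d) *: b + - c^-1 *: w.
  rewrite /x1 !linE hax (br0r bil); lin_comb; try ring.
  by apply: (eq_comb (c := -1) (mulVf c0)); ring.
clearbody x1; have [c' [g [w' [hw' E]]]] := decomp fr (xx_mem fr).
have c'0 : c' = 0.
  apply: (chain_scale_inj leib ab m_gt0).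
  by rewrite -(a_br_lin leib ab c' g hw') -E (br_sqr leib) scale0r.
rewrite c'0 scale0r add0r in E.
have c1 : -1 != 0 :> K by rewrite oppr_eq0 oner_eq0.
(* As [y] is right-annihilated, replacing $x$ by $x+y$ changes $[x,x]$ by $[y,x]$ only. *)
have [|y hy Ey] := br_tail_x_surj fr c1 hw1 hax1 (k := 0) (v := - w').
  by rewrite memvN.
have fr2 := frame_change_x fr (oner_neq0 K) (memN_tail fr hy).
have y0 := br_tail1 leib ab _ hy.
apply: (classified_nonzero_normalized (d := - c^-1 * d) (g := g) fr2 hw1).
  by rewrite !linE hax1 y0; lin_comb; ring.
by rewrite !linE !y0 E Ey; lin_comb; ring.
Qed.

Lemma classified_zero_normalized a b x w : frame_of a b x -> w \in tail a 1 ->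
  br a x = w -> br b x = b -> classified.
Proof.
move=> fr hw hax hbx; have [ab abN _] := fr; have [a0 ab0 ba0 bb0 frb] := ab.
have top0 := br_top leib m_gt0 a; have ann := br_tail1 leib ab.
have htop : br (chain a m) x = 0.
  have hax' : br a x = 0 *: a + 0 *: b + w by rewrite hax; lin_comb; ring.
  by rewrite (br_top_x fr hw hax') mul0rn scale0r.
have [c [f hxb]] := br_xb fr.
(* Expand $[x,[b,x]]=[x,b]$: the right-hand side has no top component, since $R_x$ kills the top
   vector. *)
have f0 : f = 0.
  have := leib.2 x b x; rewrite hbx hxb !linE hbx htop.
  rewrite (F2_br_b leib ab) ?abN ?(xx_mem fr) // scaler0 addr0 subr0 => h.
  apply: (chain_scale_inj leib ab (leqnn m)).
  by rewrite scale0r; apply: (addrI (c *: b)); rewrite addr0.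
rewrite f0 scale0r addr0 in hxb.
have b0 : b != 0.
  apply: contra_neq (oner_neq0 K) => b0.
  by case: (free_pair frb (c := 1) (d := 0)); rewrite ?b0 ?scaler0 ?scale0r ?addr0.
(* Expanding $[x,[x,b]]$ gives $c^2=-c$: this is the origin of $\delta$. *)
have cc : c = 0 \/ c = -1.
  have := leib.2 x x b; rewrite hxb (brZr bil) hxb (brZl bil) hbx.
  rewrite (F2_br_b leib ab) ?abN ?(xx_mem fr) // sub0r scalerA => /eqP.
  rewrite -addr_eq0 -scalerDl scaler_eq0 (negPf b0) orbF.
  have -> : c * c + c = c * (c + 1) by ring.
  by rewrite mulf_eq0 addr_eq0 => /orP[] /eqP; [left|right].
have xaN : br x a \in N by case: (idN x (memN_a fr)).
have [c' [g [w' [hw' E]]]] := decomp fr xaN.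
have c'0 : c' = 0.
  apply: (chain_scale_inj leib ab m_gt0).
  by rewrite -(a_br_lin leib ab c' g hw') -E (br_sym leib) hax ann // oppr0 scale0r.
rewrite c'0 scale0r add0r in E.
(* It is the [b]-coefficient of $[[x,a],x]-[[x,x],a]=[x,[a,x]]=0$. *)
have g0 : g = 0.
  have := leib.2 x a x; rewrite hax ann // E !linE hbx => h.
  have hr : br w' x - br (br x x) a \in tail a 1.
    rewrite memvB ?(F2_br_a leib ab) ?abN ?(xx_mem fr) //.
    by apply: (br_tail_x fr hw (c := 0) (d := 0)) hw'; rewrite hax; lin_comb; ring.
  have h0 : 0 *: a + g *: b + (br w' x - br (br x x) a) = 0.
    by rewrite scale0r add0r addrA -h.
  by case: (F2_span_indep bil ab hr h0).
rewrite g0 scale0r add0r in E.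
have [y hy Ey] := tail_preimage bil a0 hw'.
have hyN : y \in N.
  by case/tailP: hy => q ->; apply: memv_suml => j _; rewrite memvZ ?(memN_chain fr).
have fr1 : frame_of a b (1 *: x - y).
  by apply: frame_change_x; rewrite ?oner_neq0 ?memvN.
have yb : br y b = 0 by rewrite (F2_br_b leib ab) ?abN.
have by0 : br b y = 0 by rewrite (F2_b_br leib ab) ?abN.
pose w1 := w - br a y.
have hw1 : w1 \in tail a 1.
  by rewrite memvB // (F2_br_mem leib ab) ?abN ?(memN_a fr).
have hax1 : br a (1 *: x - y) = w1 by rewrite !linE hax scale1r.
have hbx1 : br b (1 *: x - y) = b by rewrite !linE hbx by0 scale1r subr0.
have hxb1 : br (1 *: x - y) b = c *: b by rewrite !linE hxb yb scale1r subr0.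
have hxa1 : br (1 *: x - y) a = 0 by rewrite !linE E Ey scale1r subrr.
move: (1 *: x - y) fr1 hax1 hbx1 hxb1 hxa1 => x1 fr1 hax1 hbx1 hxb1 hxa1.
have [|||q [l hxx]] := F2_commuting leib m_gt0 ab (v := br x1 x1).
- by rewrite abN; exact: xx_mem fr1.
- have := leib.2 x1 a x1; rewrite hax1 (ann x1 _ hw1) hxa1 (br0l bil) sub0r.
  by move/esym/eqP; rewrite oppr_eq0 => /eqP.
- exact: br_sqr.
have qc : q * c = 0.
  have := br_sqr leib x1 x1; rewrite hxx !linE hxb1 top0 scaler0 addr0 scalerA.
  by move/eqP; rewrite scaler_eq0 (negPf b0) orbF => /eqP.
have [f1 Ef1] := tail1P a0 hw1.
(* As $[b,x]=b$, the shift by $-qb$ cancels $qb$ in $[x,x]$; the extra term $-q[x,b]=-qcb$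
   vanishes. *)
exists (R6 (fun i => f1 (i - 3)%N) l c), a, b, (1 *: x1 + - q *: b); split=> //.
  by apply: frame_change_x; rewrite ?oner_neq0 ?memvZ ?(memN_b fr).
split; rewrite /= !linE ?hax1 ?hbx1 ?hxb1 ?hxa1 ?hxx ?ab0 ?bb0 ?ba0.
- rewrite scale1r scaler0 !scale0r !add0r addr0 Ef1.
  by apply: eq_bigr => j _; rewrite !subSS subn0.
- by lin_comb; ring.
- by lin_comb; ring.
- by lin_comb; ring.
- lin_comb; try ring.
  by apply: (eq_comb (c := -1) qc); ring.
Qed.

Lemma classified_zero a b x d w e f : frame_of a b x -> w \in tail a 1 ->
  br a x = 0 *: a + d *: b + w -> br b x = e *: b + f *: chain a m -> e != 0 ->
  classified.
Proof.
move=> fr hw hax hbx e0; have [ab abN _] := fr; have [a0 ab0 ba0 bb0 frb] := ab.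
have top0 := br_top leib m_gt0 a; have ann := br_tail1 leib ab.
have htop : br (chain a m) x = 0.
  by rewrite (br_top_x fr hw hax) mul0rn scale0r.
have ei0 : e^-1 != 0 by rewrite invr_eq0.
have ee : e^-1 * e = 1 by rewrite mulVf.
have fr1 := frame_change_b (e^-1 * f) (frame_change_x fr ei0 (mem0v N)) (oner_neq0 K).
set x1 := _ + 0 in fr1; set b1 := _ + _ *: chain a m in fr1.
have hbx1 : br b1 x1 = b1.
  rewrite /b1 /x1 !linE (br0r bil) (br0r bil) hbx htop; lin_comb; try ring.
    by apply: (eq_comb (c := 1) ee); ring.
have hax1 : br a x1 = (e^-1 * d) *: b1 + (e^-1 *: w - (e^-1 * d * (e^-1 * f)) *: chain a m).
  by rewrite /b1 /x1 !linE (br0r bil) hax; lin_comb; ring.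
have hw1 : e^-1 *: w - (e^-1 * d * (e^-1 * f)) *: chain a m \in tail a 1.
  by rewrite memvB ?memvZ // (mem_chain_tail bil).
move: x1 b1 (_ - _) fr1 hbx1 hax1 hw1 => x1 b1 w1 fr1 hbx1 hax1 hw1.
have fr2 := frame_change_a (- (e^-1 * d)) fr1 (oner_neq0 K) (mem0v _).
apply: (classified_zero_normalized fr2 (w := w1)) => //; last first.
  by rewrite !linE hbx1 hax1 (br0l bil); lin_comb; ring.
(* Adding a multiple of [b1] to [a] leaves all later chain vectors unchanged, hence also the
   tail. *)
have [ab1 abN1 _] := fr1.
case/tailP: hw1 => q ->; apply/tailP; exists q; apply: eq_bigr => j _.
congr (_ *: _); rewrite addn1; elim: (j : nat) => [|k IH].
  rewrite -[RHS]/(br _ _) (F2_br_lin leib ab1) ?mem0v //.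
    have [_ _ ba1 _ _] := ab1.
    by rewrite !linE ba1 (br0l bil) scaler0 !addr0 !scale1r.
  by rewrite abN1 -(let: And3 _ h _ := fr2 in h) mem_a.
rewrite -[RHS]chainS (F2_br_lin leib ab1) ?mem0v // -IH ?(mem_chain bil ab1) //.
by rewrite scale1r chainS.
Qed.

Lemma frame_classified a b x : frame_of a b x -> classified.
Proof.
move=> fr; have [c [d [w [hw hax]]]] : exists c d w,
    w \in tail a 1 /\ br a x = c *: a + d *: b + w.
  by apply: (decomp fr); case: (idN x (memN_a fr)).
have [e [f hbx]] := br_bx fr.
have [c0|c0] := eqVneq c 0; last exact: (classified_nonzero fr hw hax c0).
rewrite c0 in hax; apply: (classified_zero fr hw hax hbx).
by case: (nondegenerate fr hw hax hbx) => //; rewrite eqxx.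
Qed.
End Completeness.

(** * Transport along injective morphisms *)

Section Transport.
Variables (K : numFieldType) (U V : vectType K) (m : nat).
Variables (bu : U -> U -> U) (bv : V -> V -> V) (f : 'Hom(U, V)).
Hypotheses (kf : lker f = 0%VS) (fM : forall u v, f (bu u v) = bv (f u) (f v)).

Lemma chain_hom a k : f (chain bu a k) = chain bv (f a) k.
Proof. by elim: k => // k IH; rewrite -chainS fM IH chainS. Qed.

Lemma F2_pair_hom a b : F2_pair bu m a b -> F2_pair bv m (f a) (f b).
Proof.
case=> h0 h1 h2 h3 fr; split; rewrite -?fM -?chain_hom ?h0 ?h1 ?h2 ?h3 ?linear0 //.
apply: free_pairI => c d; rewrite -!linearZ -linearD /= => h; apply: (free_pair fr).
by apply/eqP; rewrite -memv0 -kf memv_ker h.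
Qed.

Lemma F2_span_hom a b : F2_span bv m (f a) (f b) = (f @: F2_span bu m a b)%VS.
Proof.
rewrite /F2_span /tail !limgD !limg_line limg_sum; congr (_ + _)%VS.
by apply: eq_bigr => j _; rewrite limg_line chain_hom.
Qed.

Lemma realizes_hom P a b x : realizes bu m P a b x -> realizes bv m P (f a) (f b) (f x).
Proof.
case=> h1 h2 h3 h4 h5; split; rewrite -fM ?h1 ?h2 ?h3 ?h4 ?h5 ?linearN ?linearD
  !linearZ /= -?chain_hom //.
congr (_ + _); rewrite linear_sum; apply: eq_bigr => j _.
by rewrite linearZ /= chain_hom.
Qed.

End Transport.

(** * The standard pair of $F_n^2$ *)

Section F2.
Variables (K : numFieldType) (m : nat) (m_gt0 : (0 < m)%N).
Local Notation br := (@F2 K m.+2).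
Local Notation E := (e K m.+2).

Lemma F2_bilinear : bilinear_bracket br.
Proof. exact: table_bracket_bilinear. Qed.

Lemma F2_chain k : (k < m)%N -> chain br (E 1) k.+1 = E k.+3.
Proof.
elim: k => [|k IH] hk; first by rewrite -[LHS]/(br (E 1) (E 1)) /F2 table_bracket_e.
by rewrite -chainS IH 1?ltnW // /F2 table_bracket_e ?ltnS 1?ltnW //= !ltnS hk.
Qed.

Lemma F2_chain_top : chain br (E 1) m = E m.+2.
Proof. by case: (m) m_gt0 (@F2_chain m.-1) => // k _ /= ->. Qed.

Lemma F2_F2_pair : F2_pair br m (E 1) (E 2).
Proof.
split; rewrite /F2 ?table_bracket_e //; rewrite -/(@F2 K m.+2).
  by rewrite -chainS F2_chain_top /F2 table_bracket_e //=; case: (m) => //= k; rewrite ltnn.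
rewrite F2_chain_top; apply: free_pairI => c d /rowP h.
split; [have := h (inord 1) | have := h (inord m.+1)].
  by rewrite !mxE inordK // eqxx mulr1 !eqSS (ltn_eqF m_gt0) mulr0 addr0.
by rewrite !mxE inordK // eqxx mulr1 !eqSS (gtn_eqF m_gt0) mulr0 add0r.
Qed.

Lemma F2_F2_span : F2_span br m (E 1) (E 2) = fullv.
Proof.
apply/eqP; rewrite eqEdim subvf (dim_F2_span F2_bilinear F2_F2_pair).
by rewrite dimvf /dim /= mul1n.
Qed.

End F2.

Lemma classification (K : numFieldType) (m : nat) (L : vectType K)
    (br : L -> L -> L) : (0 < m)%N ->
  leibniz_algebra br -> \dim {:L} = m.+3 -> has_nilradical_F2 m.+2 br ->
  exists p : entry K, admissible p /\ alg_iso br (alg m.+2 p).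
Proof.
move=> m_gt0 leib dimL [N [nilN [f [kf imf fM]]]].
have ab := F2_pair_hom kf fM (F2_F2_pair K m_gt0).
have abN : F2_span br m (f (e K m.+2 1)) (f (e K m.+2 2)) = N.
  by rewrite (F2_span_hom m fM) F2_F2_span.
have /subvPn[x _ xN] : ~~ (fullv <= N)%VS.
  apply/negP => /dimvS; rewrite dimL -abN (dim_F2_span leib.1 ab).
  by rewrite ltnn.
have fr : frame_of br m N (f (e K m.+2 1)) (f (e K m.+2 2)) x by split.
have [p [a' [b' [x' [hp [ab' abN' xN'] rel]]]]] :=
  frame_classified leib m_gt0 dimL nilN fr.
exists p; split=> //.
apply: (x_table_alg_iso m_gt0 leib.1 dimL (x_table_of_leibniz leib.1 leib ab' rel)).
by rewrite abN'.
Qed.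

(** * Rigidity of the structure constants *)

Section Rigidity.
Variables (K : numFieldType) (L : vectType K) (br : L -> L -> L) (m : nat).
Hypotheses (leib : leibniz_algebra br) (m_gt0 : (0 < m)%N).
Let bil := leib.1.
Local Notation chain := (chain br).
Local Notation tail := (tail br m).
Let linE := (brDl bil, brDr bil, brZl bil, brZr bil, brNl bil, brNr bil).

Variables (N : {vspace L}) (P P' : xproducts K) (a b x a' b' x' : L).
Hypotheses (idN : ideal br N) (dimL : \dim {:L} = m.+3).
Hypotheses (fr : frame_of br m N a b x) (rel : realizes br m P a b x).
Hypotheses (fr' : frame_of br m N a' b' x') (rel' : realizes br m P' a' b' x').
Let ab : F2_pair br m a b. Proof. by case: fr. Qed.
Let abN : F2_span br m a b = N. Proof. by case: fr. Qed.
Let ab' : F2_pair br m a' b'. Proof. by case: fr'. Qed.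
Let abN' : F2_span br m a' b' = N. Proof. by case: fr'. Qed.
Let a0 : chain a m.+1 = 0. Proof. by case: ab. Qed.

(** If $t$ were zero, right multiplication by $a'$ would vanish on the nilradical, against $[a',a']
    \ne 0$. *)
Lemma rigid_a : exists t s w,
  [/\ t != 0, w \in tail a 1 & a' = t *: a + s *: b + w].
Proof.
have ha' : a' \in F2_span br m a b by rewrite abN -abN' mem_a.
case/F2_spanP: (ha') => t [s [w [hw E]]]; exists t, s, w; split=> //.
apply: contraNneq (chain1_neq0 leib m_gt0 ab') => t0.
rewrite -[chain a' 1]/(br a' a') {2}E (F2_br_lin leib ab) // t0 scale0r.
exact/eqP.
Qed.

(** $b'$ commutes with all of the nilradical; if $u=0$ it would be proportional to the top vector of
    the chain of $a'$. *)
Lemma rigid_b : exists u v, u != 0 /\ b' = u *: b + v *: chain a m.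
Proof.
have aN : a \in F2_span br m a' b' by rewrite abN' -abN mem_a.
have [|||u [v E]] := F2_commuting leib m_gt0 ab (v := b').
- by rewrite abN -abN' mem_b.
- exact: (F2_b_br leib ab' aN).
- exact: (F2_br_b leib ab' aN).
exists u, v; split=> //; have [t [s [w [t0 hw Ea]]]] := rigid_a.
have [topE _] := chain_change_top leib m_gt0 ab hw Ea.
apply/negP => /eqP u0; have [_ _ _ _ frb] := ab'.
have [|] := free_pair frb (c := t ^+ m.+1) (d := - v).
  by rewrite topE E u0; lin_comb; ring.
by move=> /eqP; rewrite expf_eq0 (negPf t0) andbF.
Qed.

Lemma rigid_x : exists c f g w,
  [/\ c != 0, w \in tail a 1 & x' = c *: x + (f *: a + g *: b + w)].
Proof.
have xN : x \notin F2_span br m a b by rewrite abN; case: fr.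
have [c [n [hn E]]] := frame_spanP bil ab dimL xN x'.
have [f [g [w [hw En]]]] := F2_spanP _ _ _ _ _ hn.
exists c, f, g, w; rewrite -En; split=> //.
apply/negP => /eqP c0; case: fr' => _ _ /negP; apply.
by rewrite E c0 scale0r add0r -abN.
Qed.

(** Coefficients of [a], [b] and the top vector in $[a',x']$, $[b',x']$, $[x',b']$, $[x',x']$.
    Diagonal constants only scale by $c$; the others mix with the change of frame. *)
Lemma rigid_equations t s w u v c f g z : t != 0 -> w \in tail a 1 ->
  a' = t *: a + s *: b + w -> u != 0 -> b' = u *: b + v *: chain a m ->
  z \in tail a 1 -> x' = c *: x + (f *: a + g *: b + z) ->
  [/\ ax_a P' = c * ax_a P,
      bx_b P' = c * bx_b P,
      xb_b P' = c * xb_b P,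
      c * (t * ax_b P + s * bx_b P) = ax_a P' * s + ax_b P' * u &
      c * u * bx_c P + c * v * (ax_a P *+ m.+1) = bx_b P' * v + bx_c P' * t ^+ m.+1 /\
      c * c * xx_b P + c * g * (bx_b P + xb_b P) = xx_b P' * u].
Proof.
move=> t0 hw Ea u0 Eb hz Ex.
have [topE _] := chain_change_top leib m_gt0 ab hw Ea.
have [_ ab0 ba0 bb0 _] := ab; have [hax hbx hxa hxb hxx] := rel.
have [hax' hbx' hxa' hxb' hxx'] := rel'.
have ann := br_tail1 leib ab; have top0 := br_top leib m_gt0 a.
have [n En] : exists n, n = f *: a + g *: b + z by eexists.
rewrite -En in Ex.
have nN : n \in F2_span br m a b by apply/F2_spanP; exists f, g, z.
have tl (h : nat -> K) : \sum_(j < m) h j *: chain a j.+1 \in tail a 1.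
  by apply: memv_suml => j _; rewrite memvZ // (mem_chain_tail bil).
have tl' (h : nat -> K) : \sum_(j < m) h j *: chain a' j.+1 \in tail a 1.
  apply: memv_suml => j _; rewrite memvZ //.
  have [w' hw' ->] := chain_change leib ab j hw Ea.
  rewrite memvD ?memvZ ?(mem_chain_tail bil) //.
  exact: (subvP (tail_le bil a0 (isT : 1 <= j.+2)%N)).
have htop := br_top_x leib m_gt0 fr (tl _) hax.
have wx k y : y \in tail a k.+1 -> br y x \in tail a k.+1.
  by move=> hy; apply: (br_tail_x leib fr (tl _) hax hy).
have na_tl y : y \in F2_span br m a b -> br y n \in tail a 1.
  by move=> hy; exact: (F2_br_mem leib ab).
have topt : chain a m \in tail a 1 by rewrite (mem_chain_tail bil).
have a'N : a' \in F2_span br m a b by rewrite abN -abN' mem_a.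
have b'N : b' \in F2_span br m a b by rewrite abN -abN' mem_b.
have inj := F2_span_inj bil ab.
have [e1 e2 _] : [/\ c * t * ax_a P = ax_a P' * t,
    c * (t * ax_b P + s * bx_b P) = ax_a P' * s + ax_b P' * u &
    c * t *: (\sum_(j < m) ax_c P j *: chain a j.+1) + (c * s * bx_c P) *: chain a m
      + c *: br w x + br a' n
    = ax_a P' *: w + (ax_b P' * v) *: chain a m
      + \sum_(j < m) ax_c P' j *: chain a' j.+1].
  apply: inj; rewrite ?memvD ?memvZ ?tl ?tl' ?na_tl ?wx //.
  move: hax'; rewrite {1}Ex (brDr bil) (brZr bil) {1}Ea !linE hax hbx => E.
  transitivity (ax_a P' *: a' + ax_b P' *: b' + \sum_(j < m) ax_c P' j *: chain a' j.+1).
    by rewrite -E; lin_comb; ring.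
  by rewrite {1}Ea {1}Eb; lin_comb; ring.
have ea : ax_a P' = c * ax_a P.
  by apply: (mulIf t0); rewrite -e1; ring.
have [_ _ _ _ frb] := ab.
have inj2 k l k' l' : k *: b + l *: chain a m = k' *: b + l' *: chain a m ->
    k = k' /\ l = l'.
  move=> h; have [] := free_pair frb (c := k - k') (d := l - l').
    rewrite -[RHS](subrr (k *: b + l *: chain a m)) {2}h; lin_comb; ring.
  by move=> /eqP + /eqP; rewrite !subr_eq0 => /eqP -> /eqP ->.
have [e3 e4] : c * u * bx_b P = bx_b P' * u /\
    c * u * bx_c P + c * v * (ax_a P *+ m.+1) = bx_b P' * v + bx_c P' * t ^+ m.+1.
  apply: inj2; have := hbx'; rewrite Ex topE (brDr bil) (brZr bil).
  rewrite [br b' n](F2_b_br leib ab') ?abN' -?abN //.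
  rewrite Eb !linE hbx htop => E.
  transitivity (bx_b P' *: (u *: b + v *: chain a m) + bx_c P' *: (t ^+ m.+1 *: chain a m)).
    by rewrite -E; lin_comb; ring.
  by lin_comb; ring.
have [e5 _] : c * u * xb_b P = xb_b P' * u /\ 0 = xb_b P' * v.
  apply: inj2; have := hxb'; rewrite Ex (brDl bil) (brZl bil).
  rewrite [br n b'](F2_br_b leib ab') ?abN' -?abN //.
  rewrite Eb !linE hxb !top0 => E.
  transitivity (xb_b P' *: (u *: b + v *: chain a m)); last by lin_comb; ring.
  by rewrite -E; lin_comb; ring.
(* The contributions of $f$ to the coefficients of [a] and [b] cancel, $[x,a]$ being opposite to
   that part of $[a,x]$. *)
have [_ e6 _] : [/\ 0 = 0 :> K,
    c * c * xx_b P + c * g * (bx_b P + xb_b P) = xx_b P' * u &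
    (c * c * xx_c P + c * g * bx_c P) *: chain a m
      + (c * f) *: (\sum_(j < m) ax_c P j *: chain a j.+1) + c *: br z x + br n n
    = (xx_b P' * v + xx_c P' * t ^+ m.+1) *: chain a m].
  apply: inj; rewrite ?memvD ?memvZ ?tl ?tl' ?na_tl ?wx //.
  move: hxx'; rewrite topE {1 2}Ex !(brDl bil) !(brDr bil) !(brZl bil) !(brZr bil).
  have -> : br n x = f *: br a x + g *: br b x + br z x by rewrite En !linE.
  have -> : br x n = f *: br x a + g *: br x b.
    by rewrite En !linE (ann x _ hz) addr0.
  rewrite hax hbx hxa hxb hxx => E.
  transitivity (xx_b P' *: b' + xx_c P' *: (t ^+ m.+1 *: chain a m)).
    by rewrite -E; lin_comb; ring.
  by rewrite Eb; lin_comb; ring.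
split=> //; first by apply: (mulIf u0); rewrite -e3; ring.
by apply: (mulIf u0); rewrite -e5; ring.
Qed.


(** The eigenvalue 1 on [b] forces $c=1$, then $s=0$, and $x'-x$ turns out to act trivially from the
    right on the nilradical. So both rows are coefficients of one operator, expanded in powers of
    $R_a$ and of $R_{a'}=tR_a$; the tail of $a'$ has no influence. *)
Lemma rigid_R6 :
  [/\ ax_a P = 0, ax_b P = 0, bx_b P = 1 & bx_c P = 0] ->
  [/\ ax_a P' = 0, ax_b P' = 0, bx_b P' = 1 & bx_c P' = 0] -> xx_b P' = 0 ->
  xb_b P' = xb_b P /\ exists t, [/\ t != 0,
    forall i, (i < m)%N -> ax_c P i = t ^+ i.+1 * ax_c P' i &
    xx_c P = t ^+ m.+1 * xx_c P'].
Proof.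
move=> [A1 A2 A3 A4] [B1 B2 B3 B4] B5.
have [t [s [w [t0 hw Ea]]]] := rigid_a; have [u [v [u0 Eb]]] := rigid_b.
have [c [f [g [z [c0 hz Ex]]]]] := rigid_x.
have [topE _] := chain_change_top leib m_gt0 ab hw Ea.
have [_ Ec Ed Es _] := rigid_equations t0 hw Ea u0 Eb hz Ex.
have {Ec} c1 : c = 1 by rewrite A3 B3 mulr1 in Ec.
rewrite {}c1 {c0} scale1r in Ex Ed Es.
rewrite A2 A3 B1 B2 !(mulr0, mul0r, mulr1, mul1r, add0r, addr0) in Es.
rewrite {}Es {s} scale0r addr0 mul1r in Ea Ed; split=> //; exists t.
have [_ ab0 ba0 bb0 _] := ab; have [hax hbx hxa hxb hxx] := rel.
have [hax' hbx' hxa' hxb' hxx'] := rel'.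
rewrite A1 A2 A3 A4 !scale0r ?scale1r ?add0r ?addr0 ?oppr0 in hax hbx hxa.
rewrite B1 B2 B3 B4 !scale0r ?scale1r ?add0r ?addr0 ?oppr0 in hax' hbx' hxa'.
have ann := br_tail1 leib ab; have top0 := br_top leib m_gt0 a.
have inj := F2_span_inj bil ab.
have [n Dn] : exists n, n = f *: a + g *: b + z by eexists.
rewrite -Dn in Ex.
have nN : n \in F2_span br m a b by apply/F2_spanP; exists f, g, z.
(* $[x',a']$ and $[x,a']$ vanish, hence so does $[n,a']=t[n,a]$. *)
have na : br n a = 0.
  have : br x a' + br n a' = 0 by rewrite -(brDl bil) -Ex.
  rewrite {1}Ea !linE hxa (ann x _ hw) scaler0 !add0r.
  have -> : a' = t *: a + 0 *: b + w by rewrite scale0r addr0.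
  rewrite (F2_br_lin leib ab) //.
  by move/eqP; rewrite scaler_eq0 (negPf t0) => /eqP.
have f0 : f = 0.
  apply: (chain_lead bil ab m_gt0 (br_tail bil hz)).
  by rewrite -[RHS]na Dn !linE ba0 scaler0 addr0 -[chain a 1]/(br a a).
have brn y : y \in N -> br y n = 0.
  by rewrite -abN => hy; rewrite Dn (F2_br_lin leib ab) // f0 scale0r.
have [|g' [h En]] := F2_commuting leib m_gt0 ab nN na.
  by apply: brn; rewrite -abN mem_a.
have brx y : y \in N -> br y x' = br y x.
  by move=> hy; rewrite Ex (brDr bil) brn // addr0.
have aN : a \in N by rewrite -abN mem_a.
have a0' : chain a' m.+1 = 0 by case: ab'.
have [t' [s' [_ [/(tail1P a0')[q ->] Ea']]]] : exists t' s' w', w' \in tail a' 1 /\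
    a = t' *: a' + s' *: b' + w'.
  by move: aN; rewrite -abN' => /F2_spanP.
have tab' := x_table_of_leibniz bil leib ab' rel'.
(* The shift [R_a'] acts on [N] as [t R_a], and [R_x'] is [\sum_i ax_c P' i R_a'^(i+1)]
   modulo [b']; evaluating it at [a] compares the two rows. *)
have bra' y : y \in N -> br y a' = t *: br y a.
  rewrite -abN => hy; have -> : a' = t *: a + 0 *: b + w by rewrite scale0r addr0.
  exact: (F2_br_lin leib ab).
have shift i : t ^+ i.+1 *: chain a i.+1 = t' *: chain a' i.+1
    + \sum_(j < m) q j *: chain a' (j.+1 + i.+1).
  elim: i => [|i IH].
    rewrite -[chain a 1]/(br a a) -(bra' _ aN) {1}Ea' !linE.
    have [_ _ -> _ _] := ab'; rewrite scaler0 addr0 (br_suml bil); congr (_ + _).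
    by apply: eq_bigr => j _; rewrite (brZl bil) addn1.
  have mc : chain a i.+1 \in N by rewrite -abN (mem_chain bil ab).
  rewrite exprSr -scalerA -[chain a i.+2]chainS -(bra' _ mc) -(brZl bil) IH.
  rewrite !linE (br_suml bil) chainS; congr (_ + _).
  by apply: eq_bigr => j _; rewrite (brZl bil) chainS -addnS.
have row : s' *: b' + \sum_(i < m) ax_c P' i *: (t ^+ i.+1 *: chain a i.+1)
    = \sum_(j < m) ax_c P j *: chain a j.+1.
  rewrite -hax -(brx _ aN) {2}Ea' !linE hax' hbx' (br_suml bil).
  rewrite addrAC addrC; congr (_ + _); transitivity
    (\sum_(i < m) (t' *: (ax_c P' i *: chain a' i.+1)
      + \sum_(j < m) q j *: (ax_c P' i *: chain a' (j.+1 + i.+1)))).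
    apply: eq_bigr => i _; rewrite shift scalerDr scaler_sumr.
    congr (_ + _); first by rewrite !scalerA mulrC.
    by apply: eq_bigr => j _; rewrite !scalerA mulrC.
  rewrite big_split /= -scaler_sumr exchange_big /=; congr (_ + _).
  apply: eq_bigr => j _; rewrite (brZl bil) (xt_cx tab') B1 mul0rn scale0r add0r.
  by rewrite scaler_sumr.
have s'0 : s' = 0.
  have [|||_ /eqP + _] := inj 0 (s' * u) (s' * v *: chain a m
      + \sum_(i < m) ax_c P' i *: (t ^+ i.+1 *: chain a i.+1))
    0 0 (\sum_(j < m) ax_c P j *: chain a j.+1).
  - rewrite memvD ?memvZ ?(mem_chain_tail bil) //; apply: memv_suml => j _.
    by rewrite !memvZ // (mem_chain_tail bil).
  - by apply: memv_suml => j _; rewrite memvZ // (mem_chain_tail bil).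
  - by rewrite -row Eb; lin_comb; ring.
  by rewrite mulf_eq0 (negPf u0) orbF => /eqP.
split=> //.
  move=> i hi; apply/eqP; rewrite mulrC -subr_eq0; apply/eqP; move: i hi.
  apply: (sum_tail1_eq0 bil ab (c := fun i => ax_c P i - ax_c P' i * t ^+ i.+1)).
  rewrite -[RHS](subrr (\sum_(j < m) ax_c P j *: chain a j.+1)) -{2}row s'0.
  rewrite scale0r add0r -sumrB; apply: eq_bigr => j _.
  by rewrite scalerBl scalerA.
(* Since $R_x$ kills the top vector, passing from [x] to [x + n] affects only the [b]-coefficient of
   $[x,x]$. *)
have htop : br (chain a m) x = 0.
  have hax0 : br a x = 0 *: a + 0 *: b + \sum_(j < m) ax_c P j *: chain a j.+1.
    by rewrite hax !scale0r !add0r.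
  rewrite (br_top_x leib m_gt0 fr _ hax0) ?mul0rn ?scale0r //.
  by apply: memv_suml => j _; rewrite memvZ // (mem_chain_tail bil).
move: hxx'; rewrite B5 scale0r add0r topE {1 2}Ex !(brDl bil) !(brDr bil).
have nN' : n \in N by rewrite -abN.
rewrite (brn n nN') En !linE !top0 hxx hxb hbx htop => E.
have [_ _ _ _ frb] := ab.
have [|_] := free_pair frb (c := xx_b P + g' * (xb_b P + 1))
    (d := xx_c P - t ^+ m.+1 * xx_c P').
  transitivity (xx_c P' *: (t ^+ m.+1 *: chain a m) - xx_c P' *: (t ^+ m.+1 *: chain a m)).
    by rewrite -{1}E; lin_comb; ring.
  exact: subrr.
by move/eqP; rewrite subr_eq0 => /eqP.
Qed.

End Rigidity.

(** * Absence of repetitions *)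

Section NonRedundancy.
Variables (K : numFieldType) (m : nat) (m_gt0 : (0 < m)%N).
Local Notation E := (e K m.+3).

Lemma nilradical_unique (L : vectType K) (br : L -> L -> L) (N N' : {vspace L}) :
  is_nilradical br N -> is_nilradical br N' -> N = N'.
Proof.
move=> [i1 n1 h1] [i2 n2 h2]; apply/eqP.
by rewrite eqEsubv h1 // h2.
Qed.

Lemma non_redundancy (p q : entry K) : admissible p -> admissible q ->
  alg_iso (alg m.+2 p) (alg m.+2 q) ->
  alg m.+2 p =2 alg m.+2 q \/ R6_rescaling m.+2 p q.
Proof.
move=> hp hq [f [kf imf fM]].
have leib := alg_leibniz m_gt0 hq; have bil := leib.1; have dimL := dim_row K m.
have tab := alg_x_table m_gt0 q; have xN := alg_x_notin m_gt0 q.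
have nilN := table_nilradical bil m_gt0 tab dimL xN (entry_nondegenerate m q).
set N := F2_span _ _ _ _ in nilN.
have fr : frame_of (alg m.+2 q) m N (E 1) (E 2) (E m.+3).
  by split=> //; exact: alg_F2_pair.
have ab' := F2_pair_hom kf fM (alg_F2_pair m_gt0 p).
have rel' := realizes_hom fM (alg_realizes m_gt0 p).
have tab' := x_table_of_leibniz bil leib ab' rel'.
have xN' : f (E m.+3) \notin F2_span (alg m.+2 q) m (f (E 1)) (f (E 2)).
  rewrite (F2_span_hom m fM); apply/negP => /memv_imgP[y hy].
  have fI : injective f by apply/lker0P; rewrite kf.
  by move/fI => hyx; have := alg_x_notin m_gt0 p; rewrite hyx hy.
have nilN' := table_nilradical bil m_gt0 tab' dimL xN' (entry_nondegenerate m p).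
have fr' : frame_of (alg m.+2 q) m N (f (E 1)) (f (E 2)) (f (E m.+3)).
  by split=> //; rewrite (nilradical_unique nilN nilN').
have rel := xt_x tab; have [idN _ _] := nilN.
have [t [s [w [t0 hw Ea]]]] := rigid_a leib m_gt0 fr fr'.
have [u [v [u0 Eb]]] := rigid_b leib m_gt0 fr fr'.
have [c [h [g [z [c0 hz Ex]]]]] := rigid_x leib dimL fr fr'.
have := rigid_equations leib m_gt0 fr rel fr' rel' t0 hw Ea u0 Eb hz Ex.
have R6R := rigid_R6 leib m_gt0 dimL fr rel fr' rel'.
have nR : 1 - m.+2%:R = - m.+1%:R :> K by rewrite [m.+2%:R]mulrS; ring.
have nR0 : - m.+1%:R != 0 :> K by rewrite oppr_eq0 Num.Theory.pnatr_eq0.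
have refl_eq p' : alg m.+2 p' =2 alg m.+2 p' by [].
have zero_one (y y' k k' : K) : y = 0 \/ y = 1 -> y' = 0 \/ y' = 1 ->
    k != 0 -> k' != 0 -> y * k = y' * k' -> y = y'.
  move=> hy hy' k0 k0'.
  case: hy => ->; case: hy' => -> // /eqP; rewrite mul0r mul1r.
    by rewrite eq_sym (negPf k0').
  by rewrite (negPf k0).
clear -hp hq t0 u0 c0 R6R m_gt0 nR nR0 refl_eq zero_one.
(* Most of the 36 pairs already disagree in the diagonal constants; outside [R6] the equation for
   [ax_a] gives $c=1$. *)
case: p hp R6R => [a1|a1||a1|a1|a1 l1 d1]; case: q hq => [a2|a2||a2|a2|a2 l2 d2];
  rewrite /= => hq hp R6R [e1 e2 e3 e4 [e5 e6]];
  try (have {e1} c1 : c = 1 by move/eqP: e1; rewrite mulrN1 eqr_opp => /eqP);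
  try (by move/eqP: e1; rewrite mulr0 oppr_eq0 oner_eq0);
  try (by move/esym/eqP: e1; rewrite mulrN1 oppr_eq0 (negPf c0));
  rewrite ?c1 ?mul1r ?mulr0 ?nR in e2 e3 e4 e5 e6;
  try (by case: hq); try (by case: hp);
  try (by move/eqP: e3; rewrite ?oner_eq0 // eq_sym oner_eq0);
  try (by move/eqP: e2; rewrite (negPf nR0));
  try (by move/eqP: e2; rewrite eq_sym (negPf nR0)).
- left; suff -> : a1 = a2 by exact: refl_eq.
  by apply/esym/(zero_one _ _ 1 u) => //; rewrite ?oner_neq0 // -e6; ring.
(* [R1] against [R4]: both parameters are zero and the tables coincide. *)
- left; apply: (alg_eq m_gt0) => /=; rewrite -e3 oppr0; congr XProducts.
  move/eqP: e6; rewrite addNr mulr0 addr0 eq_sym mulf_eq0 (negPf u0) orbF.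
  by move/eqP.
- by left; rewrite e2; exact: refl_eq.
(* [R2] against [R3]: with equal eigenvalues $-(m+1)$ the terms in $v$ cancel and leave $u=0$. *)
- move/eqP: e5; rewrite e2 mul0r addr0 mulr1 mulNrn [v * _]mulrC.
  by rewrite -subr_eq0 addrK (negPf u0).
- by case: hp; rewrite e2 -e3 oppr0.
- move/esym/eqP: e5; rewrite add0r mulNrn mulrC -subr_eq0 addrAC subrr add0r.
  by rewrite expf_eq0 (negPf t0) andbF.
- by left; exact: refl_eq.
- by move/eqP: e2; rewrite -e3 oppr0 (negPf nR0).
- left; apply: (alg_eq m_gt0) => /=; rewrite e3 oppr0; congr XProducts.
  by move: e6; rewrite !addr0 mulr0 addr0 mul0r.
- by case: hq; rewrite -e2 e3 oppr0.
- by move/eqP: e2; rewrite e3 oppr0 eq_sym (negPf nR0).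
- by left; rewrite e3; exact: refl_eq.
- left; suff -> : a1 = a2 by exact: refl_eq.
  apply/esym/(zero_one _ _ t u) => //; apply: (eq_comb (c := -1) e4); ring.
have [//||//|d12 [r [r0 hr lr]]] := R6R.
  by [].
right; split=> //; exists r; split=> //.
by case=> [|[|[|i]]] //= hi; rewrite hr // /scale_coef !subSS subn0.
Qed.

End NonRedundancy.

(** * Rescaling the parameters of R6 *)

Section Rescaling.
Variables (K : numFieldType) (m : nat) (m_gt0 : (0 < m)%N).

Lemma chainZ (L : vectType K) (br : L -> L -> L) t a k :
  bilinear_bracket br -> chain br (t *: a) k = t ^+ k.+1 *: chain br a k.
Proof.
move=> bil; elim: k => [|k IH]; first by rewrite expr1.
by rewrite -chainS IH (brZl bil) (brZr bil) scalerA -exprSr chainS.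
Qed.

Lemma R6_rescale_iso (a : nat -> K) (l d c : K) :
  admissible (R6 a l d) -> c != 0 ->
  alg_iso (alg m.+2 (R6 a l d))
    (alg m.+2 (R6 (scale_coef c a) (scale_last m.+2 c l) d)).
Proof.
move=> hp c0; set p := R6 a l d.
have leib := alg_leibniz m_gt0 hp; have bil := leib.1; have dimL := dim_row K m.
have ab := alg_F2_pair m_gt0 p; have xN := alg_x_notin m_gt0 p.
have rel := alg_realizes m_gt0 p.
move: (alg m.+2 p) (e K m.+3 1) (e K m.+3 2) (e K m.+3 m.+3) leib bil ab xN rel.
move=> br a1 b x leib bil ab xN [hax hbx hxa hxb hxx].
pose t := c^-1; have t0 : t != 0 by rewrite invr_eq0.
have ct : c * t = 1 by rewrite mulfV.
have ctX k : c ^+ k * t ^+ k = 1 by rewrite -exprMn ct expr1n.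
have chE k : chain br (t *: a1) k = t ^+ k.+1 *: chain br a1 k by exact: chainZ.
have [a0 ab0 ba0 bb0 frb] := ab.
have ab' : F2_pair br m (t *: a1) b.
  split; rewrite ?chE ?a0 ?scaler0 ?(brZl bil) ?(brZr bil) ?ab0 ?ba0 ?bb0 ?scaler0 //.
  apply: free_pairI => f g; rewrite scalerA => /(free_pair frb)[-> /eqP].
  by rewrite mulf_eq0 expf_eq0 (negPf t0) andbF orbF => /eqP.
have xN' : x \notin F2_span br m (t *: a1) b.
  apply: contra xN; apply/subvP; rewrite !subv_add -!memvE memvZ ?mem_a // mem_b /=.
  apply/subv_sumP => j _; rewrite -memvE chE memvZ //.
  exact: (mem_chain bil ab).
apply: (x_table_alg_iso m_gt0 bil dimL _ xN').
apply: x_table_of_leibniz => //; split; rewrite /= ?(brZl bil) ?(brZr bil) ?hax ?hbx ?hxa ?hxb ?hxx.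
- rewrite /= !scale0r !add0r scaler_sumr; apply: eq_bigr => j _.
  rewrite chE !scalerA /scale_coef !subSS subn0; congr (_ *: _).
  rewrite [t ^+ j.+2]exprS.
  by apply/esym/(eq_comb (c := t * a j.+3) (ctX j.+1)); ring.
- by rewrite /= !scale0r.
- by rewrite /= !scale0r addr0 oppr0 scaler0.
- by [].
rewrite /= chE scalerA /scale_last !subSS subn0; congr (_ + _ *: _).
by rewrite mulrAC ctX mul1r.
Qed.

(** The entry at position $j$, counted from 0 and with [l] last, is multiplied by $c^{j+1}$; the
    zero pattern is unchanged. *)
Lemma first_nonvanishing_scale (a : nat -> K) (l c : K) (c0 : c != 0) :
  let s := rcons [seq a i | i <- iota 3 m] l in
  first_nonvanishing m.+2 (scale_coef c a) (scale_last m.+2 c l)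
  = c ^+ (find (fun z => z != 0) s).+1 * first_nonvanishing m.+2 a l.
Proof.
rewrite /first_nonvanishing; have -> : (m.+2 - 2 = m)%N by rewrite !subSS subn0.
set s := rcons [seq a i | i <- _] l; set s' := rcons _ _; move=> /=.
have sz : size s' = size s by rewrite !size_rcons !size_map.
have nthE j : (j < size s)%N -> s'`_j = c ^+ j.+1 * s`_j.
  rewrite !size_rcons !size_map size_iota ltnS !nth_rcons !size_map size_iota => hj.
  case: ltngtP hj => // [hj _|-> _]; last first.
    by rewrite /scale_last !subSS subn0.
  by rewrite !(nth_map 0%N) ?size_iota // nth_iota // /scale_coef.
pose nz := fun z : K => z != 0; rewrite -/nz.
have -> : find nz s' = find nz s.
  suff Es : [seq nz z | z <- s'] = [seq nz z | z <- s].
    by have := congr1 (find id) Es; rewrite !find_map.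
  apply: (@eq_from_nth _ false); rewrite ?size_map // => j hj.
  rewrite !(nth_map 0) -?sz // nthE -?sz // /nz mulf_eq0 expf_eq0.
  by rewrite (negPf c0) andbF.
case: (ltnP (find nz s) (size s)) => h; first exact: nthE.
by rewrite !nth_default ?mulr0 ?sz.
Qed.

End Rescaling.

(* Since R1 0 and R4 0 are the same multiplication table, and R6 is listed up to
   rescaling, "pairwise non-isomorphic" says that isomorphic entries have the
   same table or are rescalings of each other. *)
Theorem theorem4p7 (R : realType) (n : nat) (hn : (3 <= n)%N) :
  [/\ (* the listed algebras belong to the class being classified *)
      forall p : entry R[i], admissible p ->
        [/\ leibniz_algebra (alg n p), solvable_algebra (alg n p) &
            has_nilradical_F2 n (alg n p)],
      (* completeness of the list *)
      forall (L : vectType R[i]) (br : L -> L -> L),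
        leibniz_algebra br -> \dim {:L} = n.+1 ->
        solvable_algebra br -> has_nilradical_F2 n br ->
        exists p : entry R[i], admissible p /\ alg_iso br (alg n p),
      (* no repetition in the list *)
      forall p q : entry R[i], admissible p -> admissible q ->
        alg_iso (alg n p) (alg n q) ->
        alg n p =2 alg n q \/ R6_rescaling n p q &
      (* the first nonvanishing parameter of R6 can be scaled to 1 *)
      forall (a : nat -> R[i]) (l d : R[i]), admissible (R6 a l d) ->
        first_nonvanishing n a l != 0 ->
        exists c : R[i],
          [/\ c != 0,
              first_nonvanishing n (scale_coef c a) (scale_last n c l) = 1 &
              alg_iso (alg n (R6 a l d))
                (alg n (R6 (scale_coef c a) (scale_last n c l) d))]].
Proof.
case: n hn => [|[|m]] // m_gt0; split.
- by move=> p hp; exact: alg_class.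
- by move=> L br leib dimL _ nilr; exact: classification.
- by move=> p q hp hq; exact: non_redundancy.
move=> a l d hp h0; pose s := rcons [seq a i | i <- iota 3 m] l.
have [c c_exp] : exists c : R[i], c ^+ (find (fun z => z != 0) s).+1
    = (first_nonvanishing m.+2 a l)^-1.
  (* Complex numbers have roots of every positive order. *)
  by eexists; apply: Num.Theory.rootCK.
have c0 : c != 0.
  by apply: contra_neq (invr_neq0 h0) => c0; rewrite -c_exp c0 expr0n.
exists c; split=> //; last exact: R6_rescale_iso.
by rewrite first_nonvanishing_scale // c_exp mulVf.
Qed.
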